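(* Let $n\ge1$. The Lie algebra $\mathrm{Vect}(\mathrm{sh}^{(n)})$ of global vector fields on $\mathrm{sh}^{(n)}$ has as a basis the vector fields $e_i,h_i,f_i$ ($i=0,\ldots,n-1$) and $L_i$ ($i=0,\ldots,n-2$).
   Context: Fusion products. Let $e,h,f$ be the standard basis of $\mathfrak{sl}_2(\mathbb C)$ and write $x_j=x\otimes t^j$. For positive integers $A=(a_1,\ldots,a_n)$ choose pairwise distinct $z_1,\ldots,z_n\in\mathbb C$, let $\mathbb C^{a}$ be the $a$-dimensional irreducible $\mathfrak{sl}_2$-module, and $\mathbb C^{a_i}(z_i)$ the $\mathfrak{sl}_2\otimes\mathbb C[t]$-module on which $x_j$ acts as $z_i^jx$. Let $\overline{v_A}\in\bigotimes_i\mathbb C^{a_i}(z_i)$ be the tensor product of lowest weight vectors and $F_s$ the span of all $x^{(1)}_{i_1}\cdots x^{(k)}_{i_k}\overline{v_A}$ with $x^{(j)}\in\mathfrak{sl}_2$, $i_1+\cdots+i_k\le s$. The fusion product is the associated graded $\mathfrak{sl}_2\otimes\mathbb C[t]$-module $M^A=\bigoplus_sF_s/F_{s-1}$, with $v_A$ the image of $\overline{v_A}$. Known facts: up to isomorphism $M^A$ is independent of the $z_i$ and of the order of the $a_i$; $\mathfrak{sl}_2\otimes t^j$ acts by $0$ for $j\ge n$; $M^A=\mathbb C[e_0,\ldots,e_{n-1}]v_A\simeq\mathbb C[e_0,\ldots,e_{n-1}]/I_A$ with $I_A$ generated by $\sum_{i_1+\cdots+i_k=s}e_{n-1-i_1}\cdots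 e_{n-1-i_k}$ for $k\ge1$, $s<\sum_{j=1}^n\max(k+1-a_j,0)$; $\dim M^A=\prod a_i$. Schubert variety. $\mathrm G=SL_2(\mathbb C[t]/t^n)$ acts on $M^A$ and on $\mathbb P(M^A)$; $[v]$ denotes the line $\mathbb Cv$; $\mathrm{sh}_A=\overline{\mathrm G\cdot[v_A]}\subset\mathbb P(M^A)$. For $2\le a_1<\cdots<a_n$, $\mathrm{sh}_A$ is a smooth projective variety which depends, up to a $\mathrm G$-equivariant isomorphism preserving the base points $[v_A]$, only on $n$; it is denoted $\mathrm{sh}^{(n)}$. Vector fields. On $M^A$ there act operators $L_i$, $i\ge0$ (coming from the Virasoro algebra), determined by $L_iv_A=0$ and $[L_i,x_j]=-j\,x_{i+j}$ for $x\in\mathfrak{sl}_2$, $j\ge 0$. An operator $X$ among $e_i,h_i,f_i$ ($0\le i\le n-1$), $L_i$ ($0\le i\le n-2$) defines the vector field on $\mathrm{sh}^{(n)}=\mathrm{sh}_A\subset\mathbb P(M^A)$ whose value at $[x]$ is $\frac{\partial}{\partial\varepsilon}\exp(\varepsilon X)[x]\big|_{\varepsilon=0}$ (this vector is tangent to $\mathrm{sh}_A$). *)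

(* Defs.v *)
From mathcomp Require Import all_boot all_order all_algebra.
From mathcomp Require Import mpoly.

Set Implicit Arguments.
Unset Strict Implicit.
Unset Printing Implicit Defensive.

Import GRing.Theory.
Local Open Scope ring_scope.

Definition sl2_e (C : fieldType) : 'M[C]_2 := delta_mx 0 1.
Definition sl2_f (C : fieldType) : 'M[C]_2 := delta_mx 1 0.
Definition sl2_h (C : fieldType) : 'M[C]_2 := delta_mx 0 0 - delta_mx 1 1.

(* The a-dimensional irreducible module has the basis u_0, ..., u_(a-1) with
     e u_k = u_(k+1),  h u_k = (2k - (a-1)) u_k,  f u_k = k (a-k) u_(k-1),
   so that u_0 is a lowest weight vector.  The matrix [irr a x] acts on column
   vectors; it is meaningful for x in sl_2 only, where
   x = x_01 e + x_00 h + x_10 f. *)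
Definition irr (C : fieldType) (a : nat) (x : 'M[C]_2) : 'M[C]_a :=
  \matrix_(r, c)
    (x 0 1 * (r == c.+1 :> nat)%:R
     + x 0 0 * ((r == c)%:R * ((2 * c)%:R - a.-1%:R))
     + x 1 0 * ((c == r.+1 :> nat)%:R * (c * (a - c))%:R)).

(* The function [u] stands for the sum over m of u(m) times the tensor product
   over i of the basis vectors u_(m i). *)
Definition tensor (C : fieldType) (n : nat) (a : 'I_n -> nat) : vectType C :=
  {ffun {dffun forall i : 'I_n, 'I_(a i)} -> C^o}.

Definition lowest (C : fieldType) (n : nat) (a : 'I_n -> nat) : tensor C a :=
  [ffun m : {dffun forall i : 'I_n, 'I_(a i)} =>
     ([forall i, m i == 0 :> nat])%:R].

(* The action of x (x) t^j: the i-th summand applies z_i^j x to the i-th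
   tensor factor. *)
Definition ev_act (C : fieldType) (n : nat) (a : 'I_n -> nat) (z : 'I_n -> C)
    (x : 'M[C]_2) (j : nat) (u : tensor C a) : tensor C a :=
  [ffun m : {dffun forall i : 'I_n, 'I_(a i)} =>
     \sum_(i < n) \sum_(k < a i)
        z i ^+ j * irr (a i) x (m i) k * u (finfun (dfwith m k))].

(* A word (x^(1), i_1), ..., (x^(k), i_k) stands for the monomial
   x^(1)_(i_1) ... x^(k)_(i_k). *)
Definition word_act (C : fieldType) (V : Type) (act : 'M[C]_2 -> nat -> V -> V)
    (w : seq ('M[C]_2 * nat)) (v : V) : V :=
  foldr (fun p u => act p.1 p.2 u) v w.

Definition word_ok (C : fieldType) (s : nat) (w : seq ('M[C]_2 * nat)) : bool :=
  all (fun p => \tr p.1 == 0) w && (\sum_(p <- w) p.2 <= s)%N.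

Definition filt (C : fieldType) (n : nat) (a : 'I_n -> nat) (z : 'I_n -> C)
    (s : nat) (u : tensor C a) : Prop :=
  exists (r : nat) (c : 'I_r -> C) (w : 'I_r -> seq ('M[C]_2 * nat)),
    (forall l, word_ok s (w l)) /\
    u = \sum_(l < r) c l *: word_act (@ev_act C n a z) (w l) (lowest C a).

(* The module (M, act), with the vector v, is the associated graded module
   (+)_s F_s / F_(s-1) with the class of the lowest weight vector: [gr s],
   restricted to F_s, is the projection of F_s to F_s / F_(s-1), seen in M.
   Only the values of [gr s] on F_s and of [act x] for x in sl_2 matter. *)
Definition fusion_product (C : fieldType) (n : nat) (a : 'I_n -> nat)
    (z : 'I_n -> C) (M : vectType C) (act : 'M[C]_2 -> nat -> 'End(M)) (v : M)
    : Prop :=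
  exists gr : nat -> 'Hom(tensor C a, M),
  [/\ (forall s u, filt z s u ->
         gr s u = 0 <-> (if s is s'.+1 then filt z s' u else u = 0)),
      (forall m : M, exists (N : nat) (u : 'I_N -> tensor C a),
         (forall s : 'I_N, filt z s (u s)) /\ m = \sum_(s < N) gr s (u s)),
      (forall (N : nat) (u : 'I_N -> tensor C a),
         (forall s : 'I_N, filt z s (u s)) -> \sum_(s < N) gr s (u s) = 0 ->
         forall s : 'I_N, gr s (u s) = 0),
      (forall (x : 'M[C]_2) (j s : nat) (u : tensor C a),
         \tr x = 0 -> filt z s u ->
         act x j (gr s u) = gr (s + j)%N (ev_act z x j u)) &
      v = gr 0%N (lowest C a)].

(* The exponential of a nilpotent operator. *)
Definition nexp (C : fieldType) (M : vectType C) (X : M -> M) (u : M) : M :=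
  \sum_(k < (\dim {:M}).+1) (k`!%:R)^-1 *: iter k X u.

(* The action of x (x) p, for p in C[t]/t^n. *)
Definition cur_act (C : fieldType) (M : vectType C) (n : nat)
    (act : 'M[C]_2 -> nat -> 'End(M)) (x : 'M[C]_2)
    (p : {poly %/ ('X^n : {poly C})}) (u : M) : M :=
  \sum_(j < n) (p : {poly C})`_j *: act x j u.

(* [rho] integrates the action of the Lie algebra to the group SL_2(C[t]/t^n).
   As this group is generated by the elementary matrices 1 + p e and 1 + p f,
   [rho] is determined on it.  For n > 0, {poly %/ 'X^n} is C[t]/t^n. *)
Definition integrates (C : fieldType) (M : vectType C) (n : nat)
    (act : 'M[C]_2 -> nat -> 'End(M))
    (rho : 'M[{poly %/ ('X^n : {poly C})}]_2 -> 'End(M)) : Prop :=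
  [/\ rho 1%:M = \1%VF,
      (forall g g', \det g = 1 -> \det g' = 1 ->
         rho (g *m g') = (rho g \o rho g')%VF),
      (forall p u,
         rho (1%:M + p *: delta_mx 0 1) u = nexp (cur_act act (sl2_e C) p) u) &
      (forall p u,
         rho (1%:M + p *: delta_mx 1 0) u = nexp (cur_act act (sl2_f C) p) u)].

(* Coordinates refer to the fixed basis [vbasis {:M}] of M. *)
Definition peval (C : fieldType) (M : vectType C) (p : {mpoly C[\dim {:M}]})
    (x : M) : C := p.@[fun i => coord (vbasis {:M}) i x].

(* The differential of p at x, applied to w. *)
Definition pdiff (C : fieldType) (M : vectType C) (p : {mpoly C[\dim {:M}]})
    (x w : M) : C :=
  \sum_i peval (mderiv i p) x * coord (vbasis {:M}) i w.

(* A subset X of the projective space P(M) is encoded by the set of the nonzero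
   vectors x whose line [x] belongs to X. *)
Definition Zariski_closure (C : fieldType) (M : vectType C) (S : M -> Prop)
    (x : M) : Prop :=
  x != 0 /\
  forall (d : nat) (p : {mpoly C[\dim {:M}]}), p \is d.-homog ->
    (forall y, S y -> peval p y = 0) -> peval p x = 0.

(* sh_A, the closure of the orbit of [v]. *)
Definition schubert (C : fieldType) (M : vectType C) (n : nat)
    (rho : 'M[{poly %/ ('X^n : {poly C})}]_2 -> 'End(M)) (v : M) : M -> Prop :=
  Zariski_closure (fun y => exists g, \det g = 1 /\ y = rho g v).

(* The tangent space of P(M) at [x] is Hom(C x, M / C x).  A tangent vector at
   [x] is represented by a vector w of M, taken modulo C x and standing for the
   homomorphism sending x to the class of w.  Hence a vector field is a map
   xi : M -> M whose values xi x, for x in X, matter modulo C x only, and which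
   is homogeneous of degree 1 modulo C x. *)
Definition vf_eq (C : fieldType) (M : vectType C) (X : M -> Prop)
    (xi eta : M -> M) : Prop :=
  forall x, X x -> exists b : C, xi x = eta x + b *: x.

Definition vf_homogeneous (C : fieldType) (M : vectType C) (X : M -> Prop)
    (xi : M -> M) : Prop :=
  forall (x : M) (c : C), X x -> c != 0 ->
    exists b : C, xi (c *: x) = c *: xi x + b *: x.

(* By Euler's formula the condition depends on xi x modulo C x only. *)
Definition vf_tangent (C : fieldType) (M : vectType C) (X : M -> Prop)
    (xi : M -> M) : Prop :=
  forall (d : nat) (p : {mpoly C[\dim {:M}]}), p \is d.-homog ->
    (forall y, X y -> peval p y = 0) ->
    forall x, X x -> pdiff p x (xi x) = 0.

(* Near every point of X, xi is modulo C x of the form P(x) / q(x) with P a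
   polynomial map M -> M homogeneous of degree d+1 and q a form of degree d. *)
Definition vf_regular (C : fieldType) (M : vectType C) (X : M -> Prop)
    (xi : M -> M) : Prop :=
  forall x0, X x0 ->
  exists (d : nat) (q : {mpoly C[\dim {:M}]})
         (P : 'I_(\dim {:M}) -> {mpoly C[\dim {:M}]}),
  [/\ q \is d.-homog, (forall i, P i \is d.+1.-homog), peval q x0 != 0 &
      forall x, X x -> peval q x != 0 ->
        exists b : C,
          xi x = (peval q x)^-1 *: (\sum_i peval (P i) x *: (vbasis {:M})`_i)
                 + b *: x].

Definition vector_field (C : fieldType) (M : vectType C) (X : M -> Prop)
    (xi : M -> M) : Prop :=
  [/\ vf_homogeneous X xi, vf_tangent X xi & vf_regular X xi].

Definition vf_basis (C : fieldType) (M : vectType C) (X : M -> Prop)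
    (I : finType) (xi : I -> M -> M) : Prop :=
  [/\ (forall i, vector_field X (xi i)),
      (forall c : I -> C,
         vf_eq X (fun x => \sum_i c i *: xi i x) (fun _ => 0) ->
         forall i, c i = 0) &
      (forall eta, vector_field X eta ->
         exists c : I -> C, vf_eq X eta (fun x => \sum_i c i *: xi i x))].

(* The value at [x] of the vector field of an operator T is the derivative of
   exp(eps T)[x] at eps = 0, that is the class of T x modulo C x. *)
Definition op_field (C : fieldType) (M : vectType C) (T : 'End(M)) : M -> M :=
  fun x => T x.

Definition virasoro_ops (C : fieldType) (M : vectType C)
    (act : 'M[C]_2 -> nat -> 'End(M)) (v : M) (L : nat -> 'End(M)) : Prop :=
  (forall i, L i v = 0) /\
  (forall (x : 'M[C]_2) (i j : nat) (u : M), \tr x = 0 ->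
     L i (act x j u) - act x j (L i u) = - (j%:R *: act x (i + j)%N u)).

(* The index type is the disjoint union of the index sets of the e_i, the h_i,
   the f_i and the L_i. *)
Definition schubert_fields (C : fieldType) (M : vectType C) (n : nat)
    (act : 'M[C]_2 -> nat -> 'End(M)) (L : nat -> 'End(M))
    (k : 'I_n + 'I_n + 'I_n + 'I_n.-1) : M -> M :=
  op_field (match k with
            | inl (inl (inl i)) => act (sl2_e C) i
            | inl (inl (inr i)) => act (sl2_h C) i
            | inl (inr i) => act (sl2_f C) i
            | inr i => L i
            end).

(* Main.v *)
From HB Require Import structures.
Require Import Defs.
From mathcomp Require Import all_boot all_order all_algebra.
From mathcomp Require Import mpoly complex reals ring zify.

Set Implicit Arguments.
Unset Strict Implicit.
Unset Printing Implicit Defensive.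

Import Order.TTheory GRing.Theory Num.Theory.
Local Open Scope ring_scope.

(* Write A = C[t]/t^n.  The points [exp(e(p)) v], p in A, form a dense cell of
   the Schubert variety, and its tangent space at such a point x is spanned by
   the vectors e_i x; so a vector field restricts on the cell to a map
   G : A -> A, the value at x being e(G(p)) x.  On the cell the fields e_i, h_i,
   f_i, L_i are given by t^i, 2 t^i p, - t^i p^2, - t^(i+1) p', so the claim is
   that G is of the form al + be p + ga p^2 + de t p'.

   The translate of the cell by the Weyl element is a second chart, where the
   field is given by Gt(q) = q^2 G(-1/q).  On a line through 0, G and Gt have no
   poles, hence are polynomial; comparing G(s p) with Gt(-1/(s p)) shows that
   G(p) = G(0) + g(p) + p^2 Gt(0) for p a unit, where g is linear and
   p^2 g(1/p) is linear in p too.  After subtracting g(1) p, the second order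
   term of this last condition at p = 1 says that g(a^2) = 2 a g(a), so that g
   is a derivation of A.  This uses only the two charts: no compactness and no
   coordinates at the boundary divisors. *)

(** * The tensor product of evaluation modules *)

(** The fusion product enters through the relations collected in [lowest_current_module]. Among
    them, the independence of [v] and the [e_i v] makes the cell a faithful copy of A; it is a
    Vandermonde statement about the distinct points [z_i], and [a_i >= 2] provides a room for [e] in
    every tensor factor. The grading by the number of [e]'s is recovered from [h_0]: its eigenvalues
    [lam + 2 k] are distinct, so polynomials in [h_0] play the role of projections.

    The main obstacle is to bound tangent vectors from above, since a tangent vector is given only
    as one annihilated by all equations of a closure. Explicit homogeneous equations are therefore
    written down, saying that a point is proportional to the exponential of its own coordinates;
    their linear part at [v] leaves only the span of [v] and the [e_i v], and the group carries this
    to every point of both charts.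

    The comparison of the charts speaks only of invertible [p]. This suffices because a form
    vanishing at the cell points with [p] a unit vanishes on the whole variety; equality of two
    fields modulo the line of the point is brought to this shape by taking minors. *)

Section Irr.
Variable C : fieldType.

Lemma irr_eE a (r c : 'I_a) : irr a (sl2_e C) r c = (r == c.+1 :> nat)%:R.
Proof. by rewrite !mxE /= mul1r !mul0r !addr0. Qed.

Lemma irr_hE a (r c : 'I_a) :
  irr a (sl2_h C) r c = (r == c)%:R * ((2 * c)%:R - a.-1%:R).
Proof. by rewrite !mxE /= !subr0 !mul0r mul1r addr0 add0r. Qed.

Lemma irr_fE a (r c : 'I_a) :
  irr a (sl2_f C) r c = (c == r.+1 :> nat)%:R * (c * (a - c))%:R.
Proof. by rewrite !mxE /= !mul0r mul1r !add0r. Qed.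

Lemma irr_linear a k (x y : 'M[C]_2) : irr a (k *: x + y) = k *: irr a x + irr a y.
Proof. by apply/matrixP => r c; rewrite !mxE; ring. Qed.

Lemma comm_mxE a (A B : 'M[C]_a) r c :
  (A *m B - B *m A) r c = \sum_j A r j * B j c - \sum_j B r j * A j c.
Proof. by rewrite !mxE. Qed.

Lemma irr_he a :
  irr a (sl2_h C) *m irr a (sl2_e C) - irr a (sl2_e C) *m irr a (sl2_h C)
  = 2%:R *: irr a (sl2_e C).
Proof.
apply/matrixP => r c; rewrite comm_mxE [RHS]mxE.
rewrite (bigD1 r) //= [X in _ - X](bigD1 c) //= !big1.
- rewrite !irr_eE !irr_hE !eqxx; case: eqP => [->|_];
  last by rewrite !(mulr0, mul0r) !addr0 subr0.
  rewrite !natrM -[c.+1]addn1 natrD /= !mulr1n; ring.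
- by move=> s ne; rewrite irr_hE (negbTE ne) mul0r mulr0.
- by move=> s ne; rewrite irr_hE eq_sym (negbTE ne) !mul0r.
Qed.

Lemma irr_fe a :
  irr a (sl2_f C) *m irr a (sl2_e C) - irr a (sl2_e C) *m irr a (sl2_f C)
  = - irr a (sl2_h C).
Proof.
apply/matrixP => r c; rewrite comm_mxE [RHS]mxE.
(* The formula also covers the top index [c.+1 = a], where [e] gives 0: there the truncated
   difference [a - c.+1] is 0. *)
have -> : \sum_j irr a (sl2_f C) r j * irr a (sl2_e C) j c
  = (r == c)%:R * (c.+1 * (a - c.+1))%:R.
  have [lt_ca|ge_ca] := ltnP c.+1 a.
    rewrite (bigD1 (Ordinal lt_ca)) //= big1 ?addr0.
      rewrite irr_fE irr_eE /= eqxx mulr1 eqSS (inj_eq val_inj) eq_sym; done.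
    move=> s ne; rewrite irr_eE; case: eqP => [es|]; last by rewrite mulr0.
    by case/eqP: ne; apply: val_inj.
  have -> : (a - c.+1 = 0)%N by apply/eqP; rewrite subn_eq0.
  rewrite muln0 mulr0 big1 //.
  move=> s _; rewrite irr_eE; case: eqP => [es|]; last by rewrite mulr0.
  by move: (ltn_ord s); rewrite es ltnNge ge_ca.
have -> : \sum_j irr a (sl2_e C) r j * irr a (sl2_f C) j c
  = (r == c)%:R * (c * (a - c))%:R.
  case c0 : (c : nat) => [|c'].
    rewrite big1 ?mulr0 // => s _; rewrite irr_fE c0 /=; by rewrite !mulr0.
  have lt_ca : (c' < a)%N by move: (ltn_ord c); rewrite c0; apply: ltnW.
  rewrite (bigD1 (Ordinal lt_ca)) //= big1 ?addr0.
    by rewrite irr_fE irr_eE /= c0 eqxx mul1r -(inj_eq val_inj) /= c0.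
  move=> s ne; rewrite irr_fE c0 eqSS; case: eqP => [es|]; last by rewrite mul0r mulr0.
  by case/eqP: ne; apply: val_inj.
rewrite irr_hE -mulrBr -mulrN; congr (_ * _).
have ca := ltn_ord c.
rewrite !natrM !natrB ?(ltnW ca) // -subn1 natrB ?(leq_trans _ ca) // -[c.+1]addn1 natrD.
ring.
Qed.

End Irr.

Section Tensor.
Variables (C : fieldType) (n : nat) (a : 'I_n -> nat) (z : 'I_n -> C).
Local Notation idx := {dffun forall i : 'I_n, 'I_(a i)}.
Local Notation T := (tensor C a).
Local Notation e_ j := (@ev_act C n a z (sl2_e C) j).
Local Notation h_ j := (@ev_act C n a z (sl2_h C) j).
Local Notation f_ j := (@ev_act C n a z (sl2_f C) j).
Local Notation low := (lowest C a).

Definition upd (m : idx) l (k : 'I_(a l)) : idx := finfun (dfwith m k).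
Arguments upd m [l] k.

Lemma upd_in m l (k : 'I_(a l)) : upd m k l = k.
Proof. by rewrite ffunE dfwith_in. Qed.

Lemma upd_out m l (k : 'I_(a l)) i : l != i -> upd m k i = m i.
Proof. by move=> ne; rewrite ffunE dfwith_out. Qed.

Lemma upd_same m l (k k' : 'I_(a l)) : upd (upd m k) k' = upd m k'.
Proof.
apply/ffunP => i; have [<-|ne] := eqVneq l i; first by rewrite !upd_in.
by rewrite !upd_out.
Qed.

Lemma upd_swap m l l' (k : 'I_(a l)) (k' : 'I_(a l')) : l != l' ->
  upd (upd m k) k' = upd (upd m k') k.
Proof.
move=> ne; apply/ffunP => i.
have [<-|ne1] := eqVneq l' i; first by rewrite upd_in upd_out // upd_in.
have [<-|ne2] := eqVneq l i; first by rewrite upd_in upd_out 1?eq_sym // upd_in.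
by rewrite !upd_out.
Qed.

Lemma upd_id m l : upd m (m l) = m.
Proof.
apply/ffunP => i; have [<-|ne] := eqVneq l i; first by rewrite !upd_in.
by rewrite !upd_out.
Qed.

Definition factor_op l (A : 'M[C]_(a l)) (u : T) : T :=
  [ffun m : idx => \sum_k A (m l) k * u (upd m k)].

Lemma factor_op_linear l A : linear (@factor_op l A).
Proof.
move=> k u w; apply/ffunP => m; rewrite !ffunE scaler_sumr -big_split /=.
by apply: eq_bigr => i _; rewrite !ffunE mulrDr scalerAr.
Qed.
HB.instance Definition _ l A :=
  GRing.isLinear.Build C T T _ (@factor_op l A) (@factor_op_linear l A).

Lemma factor_opD l (A B : 'M[C]_(a l)) u :
  factor_op (A + B) u = factor_op A u + factor_op B u.
Proof.
apply/ffunP => m; rewrite !ffunE -big_split /=.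
by apply: eq_bigr => i _; rewrite !mxE mulrDl.
Qed.

Lemma factor_opZ l k (A : 'M[C]_(a l)) u :
  factor_op (k *: A) u = k *: factor_op A u.
Proof.
apply/ffunP => m; rewrite !ffunE scaler_sumr.
by apply: eq_bigr => i _; rewrite !mxE -mulrA.
Qed.

Lemma factor_opB l (A B : 'M[C]_(a l)) u :
  factor_op (A - B) u = factor_op A u - factor_op B u.
Proof. by rewrite factor_opD -scaleN1r factor_opZ scaleN1r. Qed.

Lemma factor_opM l (A B : 'M[C]_(a l)) u :
  factor_op A (factor_op B u) = factor_op (A *m B) u.
Proof.
apply/ffunP => m; rewrite !ffunE.
under eq_bigr do rewrite ffunE upd_in mulr_sumr.
rewrite exchange_big /=; apply: eq_bigr => k _.
rewrite mxE mulr_suml; apply: eq_bigr => i _.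
by rewrite upd_same mulrA.
Qed.

Lemma factor_opC l l' (A : 'M[C]_(a l)) (B : 'M[C]_(a l')) u : l != l' ->
  factor_op A (factor_op B u) = factor_op B (factor_op A u).
Proof.
move=> ne; apply/ffunP => m; rewrite !ffunE.
under eq_bigr do rewrite ffunE upd_out // mulr_sumr.
under [RHS]eq_bigr do rewrite ffunE upd_out 1?eq_sym // mulr_sumr.
rewrite exchange_big /=; apply: eq_bigr => k _; apply: eq_bigr => k' _.
by rewrite upd_swap // mulrCA.
Qed.

Lemma ev_act_entry x j (u : T) (m : idx) : ev_act z x j u m =
  \sum_l \sum_k z l ^+ j * irr (a l) x (m l) k * u (upd m k).
Proof. by rewrite ffunE. Qed.

Lemma ev_actE x j (u : T) :
  ev_act z x j u = \sum_l z l ^+ j *: factor_op (irr (a l) x) u.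
Proof.
apply/ffunP => m; rewrite ffunE sum_ffunE; apply: eq_bigr => l _.
rewrite !ffunE scaler_sumr; apply: eq_bigr => k _.
by rewrite -mulrA.
Qed.

Lemma ev_act_linear x j : linear (@ev_act C n a z x j).
Proof.
move=> k u w; rewrite !ev_actE scaler_sumr -big_split /=.
by apply: eq_bigr => l _; rewrite linearP scalerDr !scalerA mulrC.
Qed.
HB.instance Definition _ x j :=
  GRing.isLinear.Build C T T _ (@ev_act C n a z x j) (@ev_act_linear x j).

(** Operators on different tensor factors commute, so the double sum over pairs of factors collapses
    to its diagonal, where the powers of [z l] multiply to the exponent [i + j]. *)
Lemma ev_act_comm x y w k :
  (forall l, irr (a l) x *m irr (a l) y - irr (a l) y *m irr (a l) x
             = k *: irr (a l) w) ->
  forall i j (u : T), ev_act z x i (ev_act z y j u) - ev_act z y j (ev_act z x i u)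
    = k *: ev_act z w (i + j) u.
Proof.
move=> xyw i j u; rewrite !ev_actE.
under eq_bigr do rewrite linear_sum scaler_sumr.
under [X in _ - X]eq_bigr do rewrite linear_sum scaler_sumr.
rewrite [X in _ - X]exchange_big /= -sumrB scaler_sumr; apply: eq_bigr => l _.
rewrite -sumrB (bigD1 l) //= big1 ?addr0.
  rewrite !linearZ /= !scalerA [z l ^+ j * _]mulrC -scalerDr -exprD.
  by rewrite !factor_opM -factor_opB xyw factor_opZ !scalerA mulrC.
move=> l' ne; rewrite !linearZ /= !scalerA [z l' ^+ j * _]mulrC factor_opC 1?eq_sym //.
by rewrite -scalerDr subrr scaler0.
Qed.

Lemma ev_act_ee i j u : e_ i (e_ j u) = e_ j (e_ i u).
Proof.
apply/eqP; rewrite -subr_eq0; apply/eqP.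
rewrite (@ev_act_comm _ _ (sl2_e C) 0) ?scale0r // => l.
by rewrite subrr scale0r.
Qed.

Lemma ev_act_he i j u : h_ i (e_ j u) = e_ j (h_ i u) + 2%:R *: e_ (i + j)%N u.
Proof.
rewrite -(@ev_act_comm (sl2_h C) (sl2_e C) _ 2%:R) => [|l]; last exact: irr_he.
by rewrite addrC subrK.
Qed.

Lemma ev_act_fe i j u : f_ i (e_ j u) = e_ j (f_ i u) - h_ (i + j)%N u.
Proof.
rewrite -scaleN1r -(@ev_act_comm (sl2_f C) (sl2_e C) _ (-1)) => [|l].
  by rewrite addrC subrK.
by rewrite irr_fe scaleN1r.
Qed.

(** * The filtration in terms of words in the [e_j] *)

Definition eword (w : seq nat) (u : T) : T := foldr (fun j u => e_ j u) u w.

Lemma lowestE (m : idx) : low m = [forall i, m i == 0 :> nat]%:R.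
Proof. by rewrite ffunE. Qed.

Lemma f_lowest j : f_ j low = 0.
Proof.
apply/ffunP => m; rewrite ev_act_entry big1 ?ffunE // => l _; rewrite big1 // => k _.
rewrite irr_fE lowestE; case: eqP => [km|_]; last by rewrite !(mul0r, mulr0).
case: forallP => [/(_ l)|_]; last by rewrite !mulr0.
by rewrite upd_in km.
Qed.

Lemma h_lowest j : h_ j low = (\sum_l z l ^+ j * - (a l).-1%:R) *: low.
Proof.
apply/ffunP => m; rewrite ev_act_entry ffunE scaler_suml; apply: eq_bigr => l _.
rewrite (bigD1 (m l)) //= big1 ?addr0.
  rewrite irr_hE eqxx mul1r upd_id lowestE.
  case: forallP => [/(_ l)/eqP ->|_]; last by rewrite mulr0; symmetry; apply: mulr0.
  by rewrite muln0 sub0r.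
by move=> k ne; rewrite irr_hE eq_sym (negbTE ne) mul0r mulr0 mul0r.
Qed.

(** Another description of [F_s]: only letters [e_j] are allowed. The inductive form lets linear
    arguments run by induction on the number of terms. *)
Inductive espan (s : nat) : T -> Prop :=
| espan0 : espan s 0
| espanD c w u : (sumn w <= s)%N -> espan s u -> espan s (c *: eword w low + u).

Lemma espan_add s u w : espan s u -> espan s w -> espan s (u + w).
Proof.
move=> Hu Hw; elim: Hu => [|c x u' ? ? IH]; first by rewrite add0r.
by rewrite -addrA; constructor.
Qed.

Lemma espan_scale s c u : espan s u -> espan s (c *: u).
Proof.
move=> Hu; elim: Hu => [|d x u' ? ? IH]; first by rewrite scaler0; constructor.
by rewrite scalerDr scalerA; constructor.
Qed.

Lemma espan_word s w : (sumn w <= s)%N -> espan s (eword w low).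
Proof.
move=> ws; rewrite -[eword _ _]addr0 -[eword _ _]scale1r.
by constructor => //; constructor.
Qed.

Lemma espan_leq s s' u : (s <= s')%N -> espan s u -> espan s' u.
Proof.
move=> le Hu; elim: Hu => [|c w v ws _ IH]; first by constructor.
by constructor => //; apply: leq_trans le.
Qed.

Lemma espan_act x s j : (forall w, espan (sumn w + j) (ev_act z x j (eword w low))) ->
  forall s' u, (s + j <= s')%N -> espan s u -> espan s' (ev_act z x j u).
Proof.
move=> xw s' u le Hu; elim: Hu => [|c w u' ws _ IH]; first by rewrite linear0; constructor.
rewrite linearP; apply: espan_add => //; apply: espan_scale.
have le' : (sumn w + j <= s')%N by apply: leq_trans le; rewrite leq_add2r.
exact: espan_leq le' (xw w).
Qed.

Lemma espan_e s j s' u : (s + j <= s')%N -> espan s u -> espan s' (e_ j u).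
Proof.
apply: espan_act => w; apply: (@espan_word _ (j :: w)); by rewrite /= addnC.
Qed.

Lemma espan_h s j s' u : (s + j <= s')%N -> espan s u -> espan s' (h_ j u).
Proof.
apply: espan_act; elim=> [|i w IH] /=.
  by rewrite h_lowest; apply: espan_scale; apply: (@espan_word _ [::]).
rewrite ev_act_he; apply: espan_add.
  by apply: espan_e (IH); lia.
by apply: espan_scale; apply: (@espan_word _ (_ :: _)) => /=; lia.
Qed.

(** Moving [f_j] to the right past [e_i] creates [h_(i+j)], which [espan_h] controls; at the end of
    the word [f_j] kills the lowest weight vector. *)
Lemma espan_f s j s' u : (s + j <= s')%N -> espan s u -> espan s' (f_ j u).
Proof.
apply: espan_act; elim=> [|i w IH] /=; first by rewrite f_lowest; constructor.
rewrite ev_act_fe; apply: espan_add; first by apply: espan_e (IH); lia.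
rewrite -scaleN1r; apply: espan_scale; apply: (@espan_h (sumn w)); first by lia.
exact: espan_word.
Qed.

Lemma ev_act_linear_sl2 k x y j (u : T) :
  ev_act z (k *: x + y) j u = k *: ev_act z x j u + ev_act z y j u.
Proof.
rewrite !ev_actE scaler_sumr -big_split; apply: eq_bigr => l _ /=.
by rewrite irr_linear factor_opD factor_opZ scalerDr !scalerA mulrC.
Qed.

Lemma mxtr2 (x : 'M[C]_2) : \tr x = x 0 0 + x 1 1.
Proof.
rewrite /mxtrace 2!big_ord_recl big_ord0 addr0; congr (_ + x _ _); exact: val_inj.
Qed.

(** The trailing [0] gives the right-hand side the nested shape [k *: x + y] that
    [ev_act_linear_sl2] rewrites. *)
Lemma sl2_decomp (x : 'M[C]_2) : \tr x = 0 ->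
  x = x 0 1 *: sl2_e C + (x 0 0 *: sl2_h C + (x 1 0 *: sl2_f C + 0)).
Proof.
rewrite mxtr2 => trx.
have x11 : x 1 1 = - x 0 0 by apply/eqP; rewrite -addr_eq0 addrC trx.
have ord2 (i : 'I_2) : i = 0 \/ i = 1.
  by case: i => [[|[|//]]] ?; [left|right]; apply: val_inj.
apply/matrixP => r c; rewrite !mxE.
by case: (ord2 r) => ->; case: (ord2 c) => -> /=; rewrite ?x11; ring.
Qed.

Lemma espan_sl2 x s j s' (u : T) : \tr x = 0 -> (s + j <= s')%N ->
  espan s u -> espan s' (ev_act z x j u).
Proof.
move=> /sl2_decomp -> le Hu; rewrite !ev_act_linear_sl2.
apply: espan_add; first by apply/espan_scale/(espan_e le).
apply: espan_add; first by apply/espan_scale/(espan_h le).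
apply: espan_add; first by apply/espan_scale/(espan_f le).
rewrite ev_actE big1 => [|l _]; first by constructor.
have -> : irr (a l) 0 = 0 *: (0 : 'M[C]_(a l)).
  by apply/matrixP => r c; rewrite !mxE !mul0r !addr0.
by rewrite factor_opZ scale0r scaler0.
Qed.

(** A concrete form of the Poincaré-Birkhoff-Witt argument: the letters of a word are absorbed one
    by one from the right, each raising the degree bound by its own index. *)
Lemma filt_espan s (u : T) : filt z s u -> espan s u.
Proof.
case=> r [c [w [ok ->]]]; elim/big_rec: _ => [|l v _ Hv]; first by constructor.
apply: espan_add => //; apply: espan_scale.
move: (ok l); rewrite /word_ok => /andP[].
elim: (w l) s {Hv ok} => [|[x j] w' IH] s /=.
  by move=> _ _; apply: (@espan_word _ [::]).
case/andP => /eqP trx ok'; rewrite big_cons /= => le.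
apply: (@espan_sl2 _ (s - j)) => //; first by lia.
by apply: IH => //; lia.
Qed.

Lemma filt_act x s j (u : T) : \tr x = 0 -> filt z s u -> filt z (s + j) (ev_act z x j u).
Proof.
move=> trx [r [c [w [ok ->]]]].
exists r, c, (fun l => (x, j) :: w l); split=> [l|].
  move: (ok l); rewrite /word_ok /= trx eqxx big_cons /= => /andP[-> le].
  by rewrite addnC leq_add2r.
by rewrite linear_sum; apply: eq_bigr => l _; rewrite linearZ.
Qed.

Lemma mxtr_e : \tr (sl2_e C) = 0. Proof. by rewrite mxtr2 !mxE /= addr0. Qed.
Lemma mxtr_f : \tr (sl2_f C) = 0. Proof. by rewrite mxtr2 !mxE /= addr0. Qed.
Lemma mxtr_h : \tr (sl2_h C) = 0.
Proof. by rewrite mxtr2 !mxE /= subr0 sub0r subrr. Qed.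

Lemma filt_leq s s' (u : T) : (s <= s')%N -> filt z s u -> filt z s' u.
Proof.
move=> le [r [c [w [ok ->]]]]; exists r, c, w; split=> // l.
by move: (ok l); rewrite /word_ok => /andP[-> /leq_trans]; apply.
Qed.

Lemma filt_lowest s : filt z s low.
Proof.
exists 1%N, (fun=> 1), (fun=> [::]); split; first by move=> l; rewrite /word_ok /= big_nil.
by rewrite big_ord1 scale1r.
Qed.

Lemma filt_eword w : filt z (sumn w) (eword w low).
Proof.
elim: w => [|j w IH] /=; first exact: filt_lowest.
by rewrite addnC; apply: filt_act mxtr_e IH.
Qed.

Lemma filt_scale s c (u : T) : filt z s u -> filt z s (c *: u).
Proof.
case=> r [d [w [ok ->]]]; exists r, (fun l => c * d l), w; split=> //.
by rewrite scaler_sumr; apply: eq_bigr => l _; rewrite scalerA.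
Qed.

Lemma filt_sum s r (c : 'I_r -> C) (w : 'I_r -> seq nat) :
  (forall l, (sumn (w l) <= s)%N) ->
  filt z s (\sum_l c l *: eword (w l) low).
Proof.
move=> le; exists r, c, (fun l => map (fun j => (sl2_e C, j)) (w l)); split.
  move=> l; rewrite /word_ok all_map (eq_all (a2 := predT)) ?all_predT /=.
    by rewrite big_map /= -sumnE.
  by move=> j /=; rewrite mxtr_e eqxx.
apply: eq_bigr => l _; congr (_ *: _).
by rewrite /word_act foldr_map.
Qed.

(** * The part of the filtration linear in the [e_j] *)

Definition degidx (m : idx) := (\sum_i m i)%N.

Lemma degidx_upd m l (k : 'I_(a l)) : (degidx (upd m k) + m l = degidx m + k)%N.
Proof.
rewrite /degidx (bigD1 l) //= [in RHS](bigD1 l) //= upd_in.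
rewrite (eq_bigr (fun i => m i : nat)) => [|i ne]; last by rewrite upd_out 1?eq_sym.
by rewrite -addnA [RHS]addnC [in RHS](addnC (m l : nat)).
Qed.

(** Each [e_j] raises exactly one tensor index by one; this is the weight grading of the tensor
    product. *)
Lemma eword_supp w (m : idx) : degidx m != size w -> eword w low m = 0.
Proof.
elim: w m => [|j w IH] m /=.
  rewrite lowestE /degidx; case: forallP => // m0.
  by rewrite big1 // => i _; apply/eqP/m0.
move=> ne; rewrite ev_act_entry big1 // => l _; rewrite big1 // => k _.
rewrite irr_eE; case: eqP => [mk|_]; last by rewrite mulr0 mul0r.
rewrite IH ?mulr0 //; apply: contraNneq ne => sz.
by move: (degidx_upd m k); rewrite sz mk => /eqP; lia.
Qed.

Section Linear.
Hypothesis a_ge2 : forall i, (2 <= a i)%N.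

Lemma unit_ord_subproof (i l : 'I_n) : ((i == l) < a i)%N.
Proof. by apply: leq_trans (a_ge2 i); case: eqP. Qed.

(** The basis tensor with [u_1] in position [l] and [u_0] elsewhere. These [n] indices see exactly
    the words of length one. *)
Definition unit_idx l : idx := [ffun i => Ordinal (unit_ord_subproof i l)].

Lemma unit_idxE l i : unit_idx l i = (i == l) :> nat.
Proof. by rewrite ffunE. Qed.

Lemma degidx_unit l : degidx (unit_idx l) = 1%N.
Proof.
rewrite /degidx (bigD1 l) //= unit_idxE eqxx big1 // => i ne.
by rewrite unit_idxE (negbTE ne).
Qed.

Lemma e_lowest_unit j l : e_ j low (unit_idx l) = z l ^+ j.
Proof.
have lt0 : (0 < a l)%N by apply: leq_trans (a_ge2 l).
rewrite ev_act_entry (bigD1 l) //= [X in _ + X]big1 ?addr0 => [|i ne].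
  rewrite (bigD1 (Ordinal lt0)) //= big1 ?addr0 => [|k ne].
    rewrite irr_eE unit_idxE eqxx /= mulr1 lowestE.
    case: forallP => [_|[]]; first by rewrite mulr1.
    move=> i; have [->|ne] := eqVneq i l; first by rewrite upd_in.
    by rewrite upd_out 1?eq_sym // unit_idxE (negbTE ne).
  rewrite irr_eE unit_idxE eqxx eqSS; case: eqP => [k0|]; last by rewrite mulr0 mul0r.
  by case/eqP: ne; apply: val_inj.
rewrite big1 // => k _; rewrite irr_eE unit_idxE (negbTE ne).
by rewrite mulr0 mul0r.
Qed.

(** At these indices only words of length one contribute, and [e_j] contributes the values of ['X^j]
    at the [z l]; a bound on degrees of words becomes a bound on the degree of [Q]. *)
Lemma espan_unit s u : espan s u ->
  exists2 Q : {poly C}, (size Q <= s.+1)%N & forall l, u (unit_idx l) = Q.[z l].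
Proof.
elim=> [|c w u' ws _ [Q sQ HQ]].
  by exists 0; rewrite ?size_poly0 // => l; rewrite ffunE horner0.
have [Q' sQ' HQ'] : exists2 Q' : {poly C}, (size Q' <= s.+1)%N &
    forall l, eword w low (unit_idx l) = Q'.[z l].
  have [w1|w1] := eqVneq (size w) 1%N; last first.
    exists 0; rewrite ?size_poly0 // => l.
    by rewrite horner0 eword_supp // degidx_unit eq_sym.
  case: w ws w1 => [|j [|//]] //=; rewrite addn0 => js _.
  exists 'X^j; first by rewrite size_polyXn.
  by move=> l; rewrite e_lowest_unit hornerXn.
exists (c *: Q' + Q) => [|l].
  by apply: leq_trans (size_polyD _ _) _; rewrite geq_max sQ (leq_trans (size_scale_leq
    _ _)).
by rewrite !ffunE HQ HQ' hornerD hornerZ.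
Qed.

Hypothesis z_inj : injective z.

(** Otherwise ['X^i] minus a polynomial of smaller degree would vanish at the [n] distinct points
    [z l], although its degree [i] is less than [n]. *)
Lemma e_lowest_notin i : (i < n)%N ->
  ~ (if i is s.+1 then filt z s (e_ i low) else e_ i low = 0).
Proof.
case: i => [|i] lt_in.
  move/ffunP/(_ (unit_idx (Ordinal lt_in))); rewrite e_lowest_unit ffunE expr0.
  by move/eqP; rewrite oner_eq0.
case/filt_espan/espan_unit => Q sQ HQ.
have szP : size ('X^(i.+1) - Q)%R = i.+2.
  by rewrite size_polyDl ?size_polyXn // size_polyN ltnS.
have nz : 'X^(i.+1) - Q != 0 by rewrite -size_poly_eq0 szP.
have := max_poly_roots nz (rs := [seq z l | l <- enum 'I_n]).
rewrite map_inj_uniq // enum_uniq size_map -cardE card_ord szP.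
rewrite ltnS leqNgt lt_in => H; suff: false by [].
apply: H => //; apply/allP => _ /mapP[l _ ->]; rewrite rootE !hornerE.
by rewrite -HQ e_lowest_unit subrr.
Qed.

(** Reducing ['X^j] modulo the polynomial [P] with roots [z l] expresses the vector through [e_0],
    ..., [e_(n-1)], whose degrees are at most [n.-1 <= j.-1]. *)
Lemma e_lowest_filt j : (n <= j)%N -> (0 < n)%N -> filt z j.-1 (e_ j low).
Proof.
move=> le n0.
pose P := \prod_(l < n) ('X - (z l)%:P).
have sP : size P = n.+1.
  by rewrite size_prod_XsubC /index_enum -enumT size_enum_ord.
pose Rm := 'X^j %% P.
have sR : (size Rm <= n)%N.
  by rewrite -ltnS -sP ltn_modp -size_poly_eq0 sP.
have HR l : z l ^+ j = \sum_(i < n) Rm`_i * z l ^+ i.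
  rewrite -(horner_coef_wide _ sR) -hornerXn (divp_eq 'X^j P) hornerD hornerM.
  suff -> : P.[z l] = 0 by rewrite mulr0 add0r.
  by rewrite horner_prod (bigD1 l) //= hornerXsubC subrr mul0r.
have -> : e_ j low = \sum_(i < n) Rm`_i *: eword [:: i : nat] low.
  rewrite /= ev_actE; under [RHS]eq_bigr do rewrite ev_actE scaler_sumr.
  rewrite exchange_big /=; apply: eq_bigr => l _.
  by rewrite HR scaler_suml; apply: eq_bigr => i _; rewrite scalerA.
apply: filt_sum => l /=; rewrite addn0.
by have := ltn_ord l; lia.
Qed.

End Linear.
End Tensor.

(** * The fusion product *)

Definition mword (C : fieldType) (M : vectType C)
    (act : 'M[C]_2 -> nat -> 'End(M)) (w : seq nat) (u : M) : M :=
  foldr (fun j u => act (sl2_e C) j u) u w.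

(** The facts about the fusion product that the later sections work with. [mword_ind] states in the
    form of an induction that the words in the [e_j] applied to [v] span [M]. Including [v] in
    [act_e_free] makes the [e_i v] independent modulo the line of [v], that is, as tangent
    directions at [[v]]. *)
Record lowest_current_module (C : fieldType) (n : nat) (M : vectType C)
    (act : 'M[C]_2 -> nat -> 'End(M)) (v : M) (lam : C) : Prop := {
  act_ee : forall i j u,
    act (sl2_e C) i (act (sl2_e C) j u) = act (sl2_e C) j (act (sl2_e C) i u);
  act_he : forall i j u, act (sl2_h C) i (act (sl2_e C) j u) =
    act (sl2_e C) j (act (sl2_h C) i u) + 2%:R *: act (sl2_e C) (i + j)%N u;
  act_fe : forall i j u, act (sl2_f C) i (act (sl2_e C) j u) =
    act (sl2_e C) j (act (sl2_f C) i u) - act (sl2_h C) (i + j)%N u;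
  act_fv : forall i, act (sl2_f C) i v = 0;
  act_hv : forall i, act (sl2_h C) i v = (i == 0%N)%:R * lam *: v;
  act_ev : forall j, (n <= j)%N -> act (sl2_e C) j v = 0;
  mword_ind : forall P : M -> Prop, P 0 ->
    (forall c w u, P u -> P (c *: mword act w v + u)) -> forall u, P u;
  act_e_free : forall (c0 : C) (c : 'I_n -> C),
    c0 *: v + \sum_i c i *: act (sl2_e C) i v = 0 ->
    c0 = 0 /\ forall i, c i = 0
}.

Section Fusion.
Variables (C : fieldType) (n : nat) (a : 'I_n -> nat) (z : 'I_n -> C).
Hypotheses (n_gt0 : (0 < n)%N) (a_ge2 : forall i, (2 <= a i)%N) (z_inj : injective z).
Variables (M : vectType C) (act : 'M[C]_2 -> nat -> 'End(M)) (v : M).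
Local Notation T := (tensor C a).
Local Notation low := (lowest C a).
Local Notation act_V := (@ev_act C n a z).

Lemma gr_lower (gr : nat -> 'Hom(T, M)) s t (u : T) :
  (forall s u, filt z s u ->
         gr s u = 0 <-> (if s is s'.+1 then filt z s' u else u = 0)) ->
  (t < s)%N -> filt z t u -> gr s u = 0.
Proof.
case: s => // s grP lt Fu; have [_] := grP s.+1 u (filt_leq (ltnW lt) Fu); apply.
rewrite ltnS in lt; exact: filt_leq lt Fu.
Qed.

Lemma fusion_lowest_current_module : fusion_product a z act v ->
  exists lam, lowest_current_module n act v lam.
Proof.
case=> gr [gr0 gr_span gr_free gr_act vE].
have tre := mxtr_e C; have trf := mxtr_f C; have trh := mxtr_h C.
have grw w : gr (sumn w) (eword z w low) = mword act w v.
  elim: w => [|j w IHw] /=; first by rewrite vE.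
  by rewrite addnC -gr_act ?IHw //; apply: filt_eword.
(* Words of degree exactly [s] become words in [M] under [gr s], and those of smaller degree are
   killed. *)
have mgr s u : filt z s u -> forall P : M -> Prop,
    (forall c w u, P u -> P (c *: mword act w v + u)) ->
    forall m, P m -> P (gr s u + m).
  move=> /filt_espan Hu P Pw m Pm; elim: Hu => [|c w u' ws _ IH].
    by rewrite linear0 add0r.
  rewrite linearP -addrA /=; move: ws; rewrite leq_eqVlt => /orP[/eqP es|lt].
    by rewrite -{1}es grw; apply: Pw.
  by rewrite (gr_lower gr0 lt) ?scaler0 ?add0r //; apply: filt_eword.
have grE x y i j s u : \tr x = 0 -> \tr y = 0 -> filt z s u ->
    act x i (act y j (gr s u)) = gr (s + (i + j))%N (act_V x i (act_V y j u)).
  move=> trx try Fu; rewrite gr_act // gr_act //; last exact: filt_act.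
  by rewrite -addnA [(j + i)%N]addnC.
(* The images of the [F_s] span [M], so an identity of operators can be checked in the tensor
   product. *)
have ext (f g : 'End(M)) : (forall s u, filt z s u -> f (gr s u) = g (gr s u)) -> f =1 g.
  move=> fg m; have [r [u [Fu ->]]] := gr_span m.
  by rewrite !linear_sum; apply: eq_bigr => s _; apply: fg.
(* The weight of the lowest vector of a tensor product is the sum of the lowest weights [-(a l - 1)]
   of its factors. *)
exists (\sum_l - (a l).-1%:R); split.
- move=> i j u; have := ext (act (sl2_e C) i \o act (sl2_e C) j)%VF
    (act (sl2_e C) j \o act (sl2_e C) i)%VF.
  move=> /(_ _ u); rewrite !lfunE /=; apply=> s u' Fu.
  by rewrite !lfunE /= !grE // ev_act_ee [(i + j)%N]addnC.
- move=> i j u; have := ext (act (sl2_h C) i \o act (sl2_e C) j)%VF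
    (act (sl2_e C) j \o act (sl2_h C) i + 2%:R *: act (sl2_e C) (i + j)%N)%VF.
  move=> /(_ _ u); rewrite !lfunE /=; rewrite !lfunE /=; apply=> s u' Fu.
  rewrite !lfunE /= !lfunE /= !grE // [(j + i)%N]addnC gr_act // ev_act_he.
  by rewrite linearD linearZ.
- move=> i j u; have := ext (act (sl2_f C) i \o act (sl2_e C) j)%VF
    (act (sl2_e C) j \o act (sl2_f C) i - act (sl2_h C) (i + j)%N)%VF.
  move=> /(_ _ u); rewrite !lfunE /=; rewrite !lfunE /=; apply=> s u' Fu.
  rewrite !lfunE /= !lfunE /= !grE // [(j + i)%N]addnC gr_act // ev_act_fe.
  by rewrite linearB.
- by move=> i; rewrite vE gr_act ?f_lowest ?linear0 //; apply: filt_lowest.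
- move=> i; rewrite vE gr_act //; last exact: filt_lowest.
  rewrite h_lowest linearZ /=; case: eqP => [->|/eqP i0].
    by rewrite mul1r; congr (_ *: _); apply: eq_bigr => l _; rewrite expr0 mul1r.
  by rewrite mul0r scale0r (gr_lower (t := 0) gr0) ?scaler0 ?lt0n //; apply: filt_lowest.
- move=> j le; rewrite vE gr_act //; last exact: filt_lowest.
  rewrite add0n (gr_lower (t := j.-1) gr0) //; first by lia.
  exact: e_lowest_filt.
- move=> P P0 Pw m; have [r [u [Fu ->]]] := gr_span m.
  elim/big_rec: _ => // s m' _ Pm'; exact: (mgr s (u s)).
- move=> c0 c.
  (* Both [v] and [e_0 v] have degree 0, so the term with [c0] joins the component at index 0;
     [gr_free] then separates the degrees. *)
  pose u (i : 'I_n) : T := c i *: act_V (sl2_e C) i low + (i == 0%N :> nat)%:R * c0 *: low.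
  have Fe (i : nat) : filt z i (act_V (sl2_e C) i low).
    by have := filt_eword a z [:: i]; rewrite /= addn0.
  have Fu (i : 'I_n) : filt z i (u i).
    rewrite /u; case: (i =P 0%N :> nat) => [i0|_]; last first.
      by rewrite mul0r scale0r addr0; apply/filt_scale/Fe.
    have := @filt_sum C n a z i 2 (fun k : 'I_2 => if k == 0 then c i else c0)
      (fun k => if k == 0 then [:: i : nat] else [::]).
    rewrite !big_ord_recl big_ord0 /= addr0 mul1r; apply=> l.
    by case: ifP => //=; rewrite addn0.
  move=> sum0.
  have gu : \sum_(s < n) gr s (u s) = 0.
    rewrite -[RHS]sum0 [RHS]addrC /u; under eq_bigr do rewrite linearD linearZ /=.
    rewrite big_split /=; congr (_ + _).
      by apply: eq_bigr => i _; rewrite vE gr_act //; apply: filt_lowest.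
    rewrite (bigD1 (Ordinal n_gt0)) //= mul1r big1 ?addr0 ?linearZ ?vE // => i ne.
    case: eqP => [i0|_]; last by rewrite mul0r scale0r linear0.
    by case/eqP: ne; apply: val_inj.
  have {gu} := gr_free _ _ Fu gu => gu.
  have ci (i : 'I_n) : (i != 0%N :> nat) -> c i = 0.
    move=> i0; apply/eqP; apply: contraT => cn0.
    have := gu i; rewrite /u (negbTE i0) mul0r scale0r addr0 linearZ /= => /eqP.
    rewrite scaler_eq0 (negbTE cn0) /= => /eqP /(gr0 _ _ (Fe i)) H.
    by case: (e_lowest_notin a_ge2 z_inj (ltn_ord i)).
  have := (gr0 0%N _ (Fu (Ordinal n_gt0))).1 (gu (Ordinal n_gt0)); rewrite /u /=.
  rewrite mul1r => eq0.
  (* At the index with all entries 0 the vector [e_0 low] has no component, which isolates [c0]. *)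
  have zl : c0 = 0.
    move/ffunP/(_ (finfun (fun i => Ordinal (ltnW (a_ge2 i))))): eq0.
    rewrite ffunE [X in X + _]ffunE [X in _ + X]ffunE lowestE.
    have -> : act_V (sl2_e C) 0 low (finfun (fun i => Ordinal (ltnW (a_ge2 i)))) = 0.
      apply: (@eword_supp C n a z [:: 0%N]).
      by rewrite /degidx big1 // => i _; rewrite ffunE.
    case: forallP => [_|[]]; last by move=> i; rewrite ffunE.
    rewrite ffunE => /eqP; rewrite [_ *: 0]mulr0 add0r [_ *: 1]mulr1; exact: eqP.
  split=> // i; case: (eqVneq (i : nat) 0%N) => [i0|]; last exact: ci.
  have {i0} -> : i = Ordinal n_gt0 by apply: val_inj.
  move: eq0; rewrite zl scale0r addr0 => /eqP; rewrite scaler_eq0.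
  case/orP => /eqP // e0; case: (e_lowest_notin a_ge2 z_inj n_gt0 e0).
Qed.

End Fusion.

(** * The ring C[t]/t^n and the rigidity of maps regular on both charts *)

Section PolyVanish.
Variable C : numFieldType.

(** [P * Q] vanishes everywhere, in particular at more natural numbers than its degree allows, and
    these are distinct in characteristic 0. *)
Lemma poly_vanish (P Q : {poly C}) : Q != 0 ->
  (forall s, Q.[s] != 0 -> P.[s] = 0) -> P = 0.
Proof.
move=> Q0 PQ; suff : P * Q = 0 by move/eqP; rewrite mulf_eq0 (negbTE Q0) orbF => /eqP.
apply/eqP; apply: contraT => nz.
have := max_poly_roots nz (rs := [seq i%:R | i <- iota 0 (size (P * Q)%R)]).
rewrite size_map size_iota ltnn => H; suff: false by []; apply: H.
  apply/allP => s _; rewrite rootE hornerM.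
  by have [->|/PQ ->] := eqVneq Q.[s] 0; rewrite (mulr0, mul0r).
by rewrite map_inj_uniq ?iota_uniq //; apply: mulrIn; rewrite oner_eq0.
Qed.

Lemma poly_vanish0 (P : {poly C}) : (forall s, s != 0 -> P.[s] = 0) -> P = 0.
Proof.
by move=> P0; apply: (@poly_vanish _ 'X); rewrite ?polyX_eq0 // => s;
  rewrite hornerX => /P0.
Qed.

Lemma vect_poly_vanish (V : vectType C) m (c : nat -> V) :
  (forall s : C, s != 0 -> \sum_(k < m) s ^+ k *: c k = 0) ->
  forall k, (k < m)%N -> c k = 0.
Proof.
move=> c0 k lt; rewrite (coord_vbasis (memvf (c k))) big1 // => i _.
have P0 : \poly_(j < m) coord (vbasis fullv) i (c j) = 0.
  apply: poly_vanish0 => s s0; rewrite horner_poly.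
  have := congr1 (coord (vbasis fullv) i) (c0 s s0).
  rewrite linear0 linear_sum /= => {2}<-; apply: eq_bigr => j _.
  by rewrite linearZ mulrC.
have := coef_poly m (fun j => coord (vbasis fullv) i (c j)) k.
by rewrite P0 coef0 lt => <-; rewrite scale0r.
Qed.

End PolyVanish.

Section Truncated.
Variables (C : numFieldType) (n : nat).
Hypothesis n_gt0 : (0 < n)%N.
Local Notation A := {poly %/ ('X^n : {poly C})}.
Local Notation tr := (in_qpoly ('X^n : {poly C})).
Implicit Types (p q : A) (P Q : {poly C}).

Lemma coef_qpoly p j : (n <= j)%N -> (p : {poly C})`_j = 0.
Proof.
move=> le; apply: nth_default; apply: leq_trans le.
have E : size (mk_monic ('X^n : {poly C})) = n.+1.
  by rewrite mk_monic_Xn prednK // size_polyXn.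
by rewrite -ltnS -E size_mk_monic.
Qed.

Lemma qpoly_ext p q : (forall j, (j < n)%N -> (p : {poly C})`_j = (q : {poly C})`_j) ->
  p = q.
Proof.
move=> pq; apply: val_inj; apply/polyP => j.
by have [/pq //|le] := ltnP j n; rewrite !coef_qpoly.
Qed.

Lemma coef_tr P j : (tr P : {poly C})`_j = if (j < n)%N then P`_j else 0.
Proof.
by rewrite /= mk_monic_Xn prednK // -Pdiv.RingMonic.take_poly_rmodp coef_take_poly.
Qed.

Lemma tr_val p : tr (p : {poly C}) = p.
Proof. by apply: qpoly_ext => j lt; rewrite coef_tr lt. Qed.

Lemma mulqE p q : p * q = tr ((p : {poly C}) * (q : {poly C})).
Proof. by []. Qed.

Lemma coefqM p q j : (j < n)%N ->
  (p * q : {poly C})`_j = \sum_(i < j.+1) (p : {poly C})`_i * (q : {poly C})`_(j - i).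
Proof. by move=> lt; rewrite mulqE coef_tr lt coefM. Qed.

Lemma coefqM0 p q : (p * q : A)`_0 = p`_0 * q`_0.
Proof. by rewrite coefqM // big_ord1. Qed.

Lemma coefq1 j : (1 : A)`_j = (j == 0)%:R.
Proof. by rewrite /= coefC; case: eqP. Qed.

Lemma coefqZ (c : C) p j : (c *: p : A)`_j = c * p`_j.
Proof. exact: coefZ. Qed.

Lemma coefqD p q j : (p + q : A)`_j = p`_j + q`_j.
Proof. exact: coefD. Qed.

Lemma coefq_sum I (r : seq I) (S : pred I) (F : I -> A) j :
  (\sum_(i <- r | S i) F i : A)`_j = \sum_(i <- r | S i) (F i)`_j.
Proof. by rewrite poly_of_qpoly_sum coef_sum. Qed.

Lemma qpoly_unit p : p`_0 != 0 -> exists q, p * q = 1.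
Proof.
move=> p0; exists (qpoly_inv p); rewrite mulrC; apply: qpoly_mulVz.
suff H (Q : {poly C}) : Q = 'X^n -> coprimep Q p by apply: H; rewrite mk_monic_Xn prednK.
by move=> ->; rewrite coprimep_expl // coprimep_sym coprimepX rootE horner_coef0.
Qed.

Lemma tr_Xn : tr 'X^n = 0.
Proof. by apply: qpoly_ext => j lt; rewrite coef_tr lt coefXn ltn_eqF // coef0. Qed.

Definition tX : A := tr 'X.

Lemma tXE i : tX ^+ i = tr 'X^i.
Proof. by rewrite -rmorphXn. Qed.

Lemma coef_tX i j : (tX ^+ i : A)`_j = ((j < n)%N && (j == i))%:R.
Proof. by rewrite tXE coef_tr coefXn; case: ltnP. Qed.

Lemma qpoly_sum p : p = \sum_(i < n) p`_i *: tX ^+ i.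
Proof.
apply: qpoly_ext => j lt; rewrite coefq_sum (bigD1 (Ordinal lt)) //= big1 ?addr0.
  by rewrite coefqZ coef_tX lt eqxx mulr1.
move=> i ne; rewrite coefqZ coef_tX; case: eqP => [ji|]; last by rewrite andbF mulr0.
by case/eqP: ne; apply: val_inj.
Qed.

Lemma tX_nilp i : (n <= i)%N -> tX ^+ i = 0.
Proof. by move=> le; rewrite -(subnKC le) exprD tXE tr_Xn mul0r. Qed.

(** The derivation [t d/dt]: unlike [d/dt] it preserves the ideal of [t^n], so it descends to the
    quotient. *)
Definition tderiv p : A := tr ('X * (p : {poly C})^`()).

Lemma coef_tderiv p j : (tderiv p)`_j = j%:R * p`_j.
Proof.
rewrite coef_tr; case: ltnP => [lt|le]; last by rewrite coef_qpoly ?mulr0.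
by rewrite coefXM coef_deriv; case: j {lt} => [|j] //=; rewrite ?mul0r // mulr_natl.
Qed.

Lemma tderiv_linear : linear tderiv.
Proof.
move=> k p q; apply: qpoly_ext => j lt.
rewrite coefqD coefqZ !coef_tderiv coefqD coefqZ; ring.
Qed.
HB.instance Definition _ := GRing.isLinear.Build C A A _ tderiv tderiv_linear.

Lemma qpoly_tX_factor p : (p : {poly C})`_0 = 0 -> exists q : A, p = tX * q.
Proof.
move=> p0; exists (tr ((p : {poly C}) %/ 'X)).
have Xp : 'X %| (p : {poly C}).
  have := dvdp_XsubCl (p : {poly C}) 0.
  by rewrite rootE horner_coef0 p0 eqxx polyC0 subr0.
by rewrite -rmorphM mulrC divpK //; symmetry; apply: tr_val.
Qed.

Lemma qpoly_nilp p : (p : {poly C})`_0 = 0 -> p ^+ n = 0.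
Proof. by move=> /qpoly_tX_factor[q ->]; rewrite exprMn tX_nilp ?mul0r. Qed.

Lemma qpoly_scalar_poly_vanish (P : {poly A}) :
  (forall s : C, s != 0 -> P.[s%:A] = 0) -> P = 0.
Proof.
move=> P0; apply/polyP => k; rewrite coef0; apply: qpoly_ext => j lt; rewrite coef0.
have : \poly_(i < size P) ((P`_i : A) : {poly C})`_j = 0.
  apply: poly_vanish0 => s s0; rewrite horner_poly.
  have := congr1 (fun p : A => p`_j) (P0 s s0); rewrite /= coef0 horner_coef coefq_sum => H.
  rewrite -[RHS]H; by apply: eq_bigr => i _; rewrite exprZn expr1n mulr_algr coefqZ mulrC.
move/(congr1 (fun R : {poly C} => R`_k)); rewrite coef_poly coef0.
by case: ltnP => // le _; rewrite [P`_k]nth_default ?coef0.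
Qed.

(** Multiplication by [s ^+ m], with [m] larger than the size of [R], clears the negative powers and
    gives an identity of polynomials in which [R] appears with reversed coefficients. The factor
    [s ^+ 2] lets just the three lowest coefficients of [R] reach nonnegative powers of [s]. *)
Lemma qpoly_reversal (P R : {poly A}) :
  (forall s : C, s != 0 -> P.[s%:A] = (s ^+ 2)%:A * R.[(s^-1)%:A]) ->
  P = (R`_2)%:P + R`_1 *: 'X + R`_0 *: 'X^2.
Proof.
move=> PR; pose m := (size R).+2.
have E : 'X^m * P = 'X^2 * \poly_(i < m.+1) R`_(m - i).
  apply/eqP; rewrite -subr_eq0; apply/eqP; apply: qpoly_scalar_poly_vanish => s s0.
  rewrite hornerD hornerN (hornerM 'X^m) (hornerM 'X^2) !hornerXn PR // !exprZn !expr1n.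
  rewrite [in X in _ - X](horner_poly) (horner_coef_wide _ (_ : size R <= m.+1)%N);
    last first.
    by rewrite /m; lia.
  apply/eqP; rewrite subr_eq0 mulrCA -!scalerAl !mul1r; apply/eqP; congr (_ *: _).
  rewrite (reindex_inj rev_ord_inj) scaler_sumr; apply: eq_bigr => i _ /=.
  have im : (i <= m)%N by rewrite -ltnS.
  rewrite subSS !exprZn !expr1n !mulr_algr !scalerA; congr (_ *: _).
  have -> : s ^+ m = s ^+ i * s ^+ (m - i) by rewrite -exprD subnKC.
  by rewrite exprVn mulfK // expf_neq0.
have Pk k : P`_k = if (k <= 2)%N then R`_(2 - k) else 0.
  have := congr1 (fun S : {poly A} => S`_(m + k)) E.
  rewrite coefXnM ltnNge leq_addr addKn coefXnM /= => ->.
  rewrite coef_poly; case: ltnP => lt; case: leqP => lk //; try by move: lt lk;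
    rewrite /m; lia.
  by congr (R`_ _); rewrite /m; lia.
apply/polyP => k; rewrite Pk !coefD coefC !coefZ coefX coefXn.
by case: k => [|[|[|k]]] //=; rewrite ?mulr0 ?mulr1 ?addr0 ?add0r.
Qed.

Section Rigidity.
Variables (G Gt : A -> A) (g1 gt1 : {linear A -> A}).
Hypothesis G_line : forall p, exists P : {poly A},
  (forall s : C, G (s *: p) = P.[s%:A]) /\ P`_1 = g1 p.
Hypothesis Gt_line : forall p, exists P : {poly A},
  (forall s : C, Gt (s *: p) = P.[s%:A]) /\ P`_1 = gt1 p.
Hypothesis G_inv : forall p q, p * q = -1 -> Gt q = q ^+ 2 * G p.

Lemma coef0_line (P : {poly A}) (F : A -> A) p :
  (forall s : C, F (s *: p) = P.[s%:A]) -> P`_0 = F 0.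
Proof. by move=> /(_ 0); rewrite !scale0r horner_coef0. Qed.

(** Here [G] along the line of [p] is compared with [Gt] along the line of [- q]: the product of
    [s *: p] and [- s^-1 *: q] is [-1], so [qpoly_reversal] applies up to the factor [p ^+ 2]. The
    coefficient of [s] gives the first claim, the value at [s = 1] the second. *)
Lemma rigidity_quadratic p q : p * q = 1 ->
  g1 p = - p ^+ 2 * gt1 q /\ G p = G 0 + g1 p + p ^+ 2 * Gt 0.
Proof.
move=> pq; have [P [PG P1]] := G_line p; have [R [RG R1]] := Gt_line (- q).
have E : P = ((p ^+ 2 *: R)`_2)%:P + (p ^+ 2 *: R)`_1 *: 'X + (p ^+ 2 *: R)`_0 *: 'X^2.
  apply: qpoly_reversal => s s0; rewrite -PG hornerZ -RG.
  rewrite (@G_inv (s *: p)); last by rewrite -scalerAl -scalerAr mulrN pq scalerA mulfV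
    // scale1r.
  rewrite exprZn sqrrN mulr_algl -scalerAl -scalerAr scalerA [p ^+ 2 * _]mulrA. rewrite
    -[p ^+ 2 * q ^+ 2]exprMn pq expr1n.
  by rewrite exprVn mulfV ?expf_neq0 // scale1r mul1r.
have P1' : P`_1 = p ^+ 2 * R`_1.
  by rewrite E !coefD coefC !coefZ coefX coefXn /= mulr0 add0r mulr1 addr0.
split; first by rewrite -P1 P1' R1 linearN mulrN mulNr.
have P2 : P`_2 = p ^+ 2 * Gt 0.
  by rewrite E !coefD coefC !coefZ coefX coefXn /= mulr0 !add0r mulr1 (coef0_line RG).
have P0 : P`_0 = G 0 by apply: coef0_line PG.
have := PG 1; rewrite !scale1r => ->; rewrite -P0 -P1 -P2 E.
rewrite !hornerD hornerC !hornerZ hornerX hornerXn expr1n.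
rewrite !coefD !coefC !coefZ !coefX !coefXn /=.
by rewrite !mulr0 !mulr1 !addr0 !add0r.
Qed.

(** Let [u] be the inverse of [1 - s a], a finite geometric series since [a] is nilpotent. The
    relation between [g1] and [gt1] reads [(1 - s a)^2 g1(u) = - gt1(1) + s gt1(a)]; the right-hand
    side has no term in [s^2], and the vanishing of that term on the left is the claim. *)
Lemma jordan (a : A) : (a : {poly C})`_0 = 0 -> g1 (a ^+ 2) - 2%:R * a * g1 a + a ^+ 2
  * g1 1 = 0.
Proof.
move=> a0.
(* With [n.+3] terms the series is complete, as [a ^+ n = 0], and the coefficients up to [s^2] are
   present for every [n]. *)
pose S : {poly A} := \poly_(k < n.+3) g1 (a ^+ k).
pose P : {poly A} := (1 - (2%:R * a) *: 'X + a ^+ 2 *: 'X^2) * S + (gt1 1)%:P - gt1 a *: 'X.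
have P0 : P = 0.
  apply: qpoly_scalar_poly_vanish => s s0.
  pose u := \sum_(k < n.+3) (s *: a) ^+ k.
  have uq : u * (1 - s *: a) = 1.
    rewrite mulrC -opprB mulNr -subrX1 exprZn (_ : a ^+ n.+3 = 0) ?scaler0 ?sub0r ?opprK //.
    by rewrite -addn3 exprD qpoly_nilp // mul0r.
  have [g1u _] := rigidity_quadratic uq.
  have SE : S.[s%:A] = g1 u.
    rewrite /u linear_sum horner_poly; apply: eq_bigr => i _.
    by rewrite !exprZn expr1n mulr_algr linearZ.
  rewrite /P hornerD hornerN hornerD hornerM hornerC hornerZ hornerX SE.
  rewrite hornerD hornerD hornerN !hornerZ hornerX hornerXn hornerC.
  have -> : 1 - 2%:R * a * s%:A + a ^+ 2 * s%:A ^+ 2 = (1 - s *: a) ^+ 2.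
    by rewrite -[s *: a]mulr_algl; ring.
  have gl : gt1 (s *: a) = s *: gt1 a by rewrite linearZ.
  rewrite g1u linearB gl mulr_algr.
  set c := 1 - s *: a in uq *; set x := gt1 1; set y := s *: gt1 a.
  have -> : c ^+ 2 * (- u ^+ 2 * (x - y)) = - (u * c) ^+ 2 * (x - y) by ring.
  by rewrite uq; ring.
have := congr1 (fun R : {poly A} => R`_2) P0.
rewrite /P coefB coefD mulrDl mulrDl mul1r mulNr !coefD coefN -!scalerAl !coefZ.
rewrite coefXM coefXnM !coef_poly /= coefC coefX mulr0 addr0 subr0 coef0 expr0 expr1.
by [].
Qed.

Lemma rigidity : exists al be ga de : A, forall p q, p * q = 1 ->
  G p = al + be * p + ga * p ^+ 2 + de * tderiv p.
Proof.
(* This normalization gives [d 1 = 0] and turns [jordan] into [d (a ^+ 2) = 2 a d a], which is then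
   polarized. *)
pose d (x : A) := g1 x - x * g1 1.
have dD x y : d (x + y) = d x + d y by rewrite /d linearD mulrDl; ring.
have dZ c x : d (c *: x) = c *: d x by rewrite /d linearZ /= -scalerAl scalerBr.
have d_sum I (r : seq I) (F : I -> A) : d (\sum_(i <- r) F i) = \sum_(i <- r) d (F i).
  by elim/big_rec2: _ => [|i x y _ <-]; rewrite ?dD // /d linear0 mul0r subr0.
have d2 (a : A) : (a : {poly C})`_0 = 0 -> d (a ^+ 2) = 2%:R * a * d a.
  move=> /jordan J; apply/eqP; rewrite -subr_eq0 -[X in _ == X]J /d; apply/eqP; ring.
have dM (a b : A) : (a : {poly C})`_0 = 0 -> (b : {poly C})`_0 = 0 ->
    d (a * b) = a * d b + b * d a.
  move=> a0 b0.
  have : 2%:R *: (d (a * b) - (a * d b + b * d a)) = 0.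
    have := d2 (a + b); rewrite coefqD a0 b0 addr0 => /(_ erefl).
    have -> : (a + b) ^+ 2 = a ^+ 2 + b ^+ 2 + 2%:R *: (a * b).
      by rewrite scaler_nat; ring.
    rewrite !dD dZ !d2 // scaler_nat => /eqP; rewrite -subr_eq0 => /eqP H.
    by rewrite scaler_nat -[RHS]H; ring.
  move/eqP; rewrite scaler_eq0 pnatr_eq0 /= subr_eq0 => /eqP //.
have dX i : d (tX ^+ i.+1) = i.+1%:R * tX ^+ i * d tX.
  elim: i => [|i IH]; first by rewrite expr1 expr0 !mul1r.
  rewrite exprS dM ?coef_tX ?andbF //; last by rewrite -[tX]expr1 coef_tX andbF.
  by rewrite IH [tX ^+ i.+1]exprS [i.+2%:R]mulrS; ring.
(* Applying [d] to [t^n = 0] gives [n t^(n-1) d t = 0], so [d t] has no constant term; a derivation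
   of A is thus a multiple of [t d/dt]. *)
have [w dXw] : exists w : A, d tX = tX * w.
  apply: qpoly_tX_factor.
  have := dX n.-1; rewrite prednK // tX_nilp // -[X in d X](scale0r 0) dZ scale0r.
  move/(congr1 (fun x : A => (x : {poly C})`_n.-1));
    rewrite coef0 -mulrA mulr_natl -scaler_nat.
  rewrite coefqZ coefqM ?ltn_predL // big_ord_recr /= subnn coef_tX ltn_predL n_gt0
    eqxx mul1r.
  rewrite big1 ?add0r => [/esym/eqP|i _]; last first.
    by rewrite coef_tX ltn_eqF ?andbF ?mul0r.
  by rewrite mulf_eq0 pnatr_eq0 gtn_eqF // => /eqP.
exists (G 0), (g1 1), (Gt 0), w => p q /rigidity_quadratic[_ ->].
have -> : g1 p = g1 1 * p + w * tderiv p; last by ring.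
have -> : g1 p = d p + g1 1 * p by rewrite /d mulrC subrK.
rewrite addrC; congr (_ + _).
rewrite {1}(qpoly_sum p) d_sum {2}(qpoly_sum p) linear_sum mulr_sumr.
apply: eq_bigr => i _; rewrite dZ linearZ /= -scalerAr; congr (_ *: _).
have -> : tderiv (tX ^+ i) = i%:R *: tX ^+ i.
  by apply: qpoly_ext => j lt; rewrite coef_tderiv coefqZ coef_tX lt /=;
    case: eqP => [->|]; rewrite ?mulr0.
case: (i : nat) => [|j]; first by rewrite expr0 scale0r mulr0 /d mul1r subrr.
by rewrite dX dXw scaler_nat -mulr_natl exprS; ring.
Qed.

End Rigidity.
End Truncated.

(** * Current modules generated by a lowest weight vector *)

Section Mx2.
Variable R : comNzRingType.

Definition mx2 (a b c d : R) : 'M[R]_2 :=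
  \matrix_(i, j) (if i == 0 then if j == 0 then a else b else if j == 0 then c else d).

Lemma ord2P (P : 'I_2 -> Prop) : P 0 -> P 1 -> forall i, P i.
Proof.
by move=> P0 P1; case=> [[|[|//]]] lt; [move: P0 | move: P1]; congr P; apply: val_inj.
Qed.

Lemma sum2 (F : 'I_2 -> R) : \sum_i F i = F 0 + F 1.
Proof.
by rewrite 2!big_ord_recl big_ord0 addr0; congr (_ + F _); apply: val_inj.
Qed.

Lemma mx2E (g : 'M[R]_2) : g = mx2 (g 0 0) (g 0 1) (g 1 0) (g 1 1).
Proof. by apply/matrixP; apply: ord2P; apply: ord2P; rewrite mxE. Qed.

Lemma mx2M a b c d a' b' c' d' : mx2 a b c d *m mx2 a' b' c' d' =
  mx2 (a * a' + b * c') (a * b' + b * d') (c * a' + d * c') (c * b' + d * d').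
Proof. by apply/matrixP; apply: ord2P; apply: ord2P; rewrite !mxE sum2 !mxE. Qed.

Lemma mx2_1 : 1%:M = mx2 1 0 0 1.
Proof. by apply/matrixP; apply: ord2P; apply: ord2P; rewrite !mxE. Qed.

Lemma mx2_upper p : 1%:M + p *: delta_mx 0 1 = mx2 1 p 0 1.
Proof.
by apply/matrixP; apply: ord2P; apply: ord2P; rewrite !mxE /= ?mulr0 ?mulr1 ?addr0 ?add0r.
Qed.

Lemma mx2_lower p : 1%:M + p *: delta_mx 1 0 = mx2 1 0 p 1.
Proof.
by apply/matrixP; apply: ord2P; apply: ord2P; rewrite !mxE /= ?mulr0 ?mulr1 ?addr0 ?add0r.
Qed.

Lemma det_mx2 a b c d : \det (mx2 a b c d) = a * d - b * c.
Proof.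
rewrite (expand_det_row _ 0) sum2 /cofactor !det_mx11 !mxE /= expr0 expr1.
by rewrite !mul1r !mulN1r mulrN.
Qed.

End Mx2.

Section Current.
Variables (C : numFieldType) (n : nat).
Hypothesis n_gt0 : (0 < n)%N.
Variables (M : vectType C) (act : 'M[C]_2 -> nat -> 'End(M)) (v : M) (lam : C).
Hypothesis Hv : lowest_current_module n act v lam.
Local Notation A := {poly %/ ('X^n : {poly C})}.
Local Notation e_ j := (act (sl2_e C) j).
Local Notation h_ j := (act (sl2_h C) j).
Local Notation f_ j := (act (sl2_f C) j).
Local Notation E := (@cur_act C M n act (sl2_e C)).
Local Notation F := (@cur_act C M n act (sl2_f C)).
Local Notation t := (tX C n).
Implicit Types (p q : A) (u : M).

Lemma cur_act_linear x p : linear (@cur_act C M n act x p).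
Proof.
move=> k u w; rewrite /cur_act scaler_sumr -big_split /=.
by apply: eq_bigr => i _; rewrite linearP scalerDr !scalerA mulrC.
Qed.
HB.instance Definition _ x p :=
  GRing.isLinear.Build C M M _ (@cur_act C M n act x p) (cur_act_linear x p).

Lemma cur_actD x p q u : cur_act act x (p + q) u = cur_act act x p u + cur_act act x q u.
Proof.
by rewrite /cur_act -big_split; apply: eq_bigr => i _; rewrite coefqD scalerDl.
Qed.

Lemma cur_actZ x c p u : cur_act act x (c *: p) u = c *: cur_act act x p u.
Proof.
by rewrite /cur_act scaler_sumr; apply: eq_bigr => i _; rewrite coefqZ scalerA.
Qed.

Lemma cur_act0 x u : @cur_act C M n act x 0 u = 0.
Proof. by rewrite -(scale0r 0) cur_actZ scale0r. Qed.

Lemma cur_act_sum x I (r : seq I) (G : I -> A) u :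
  cur_act act x (\sum_(i <- r) G i) u = \sum_(i <- r) cur_act act x (G i) u.
Proof.
by elim/big_rec2: _ => [|i w p _ <-]; [apply: cur_act0 | apply: cur_actD].
Qed.

Lemma cur_act_tX x i u : (i < n)%N -> cur_act act x (t ^+ i) u = act x i u.
Proof.
move=> lt; rewrite /cur_act (bigD1 (Ordinal lt)) //= big1 ?addr0 => [|j ne].
  by rewrite coef_tX // lt eqxx scale1r.
rewrite coef_tX //; case: eqP => [ji|]; last by rewrite andbF scale0r.
by case/eqP: ne; apply: val_inj.
Qed.

Lemma e_mword j w u : e_ j (mword act w u) = mword act w (e_ j u).
Proof. by elim: w => //= i w <-; rewrite (act_ee Hv). Qed.

Lemma e_big j u : (n <= j)%N -> e_ j u = 0.
Proof.
move=> le; apply: (mword_ind Hv (P := fun u => e_ j u = 0)); first exact: linear0.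
move=> c w {}u /= uP; rewrite linearD linearZ /= uP addr0 e_mword (act_ev Hv) //.
by rewrite (_ : mword act w 0 = 0) ?scaler0 //; elim: w => //= i w ->; rewrite linear0.
Qed.

Lemma E_tX j u : E (t ^+ j) u = e_ j u.
Proof.
have [/cur_act_tX //|le] := ltnP j n; by rewrite tX_nilp // cur_act0 e_big.
Qed.

Lemma E_tXM j p u : E (t ^+ j * p) u = \sum_(i < n) p`_i *: e_ (j + i)%N u.
Proof.
rewrite {1}(qpoly_sum n_gt0 p) mulr_sumr cur_act_sum; apply: eq_bigr => i _.
by rewrite -scalerAr cur_actZ -exprD E_tX.
Qed.

Lemma E_e p j u : E p (e_ j u) = e_ j (E p u).
Proof.
rewrite /cur_act linear_sum; apply: eq_bigr => i _ /=.
by rewrite linearZ /= (act_ee Hv).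
Qed.

Lemma E_comm p q u : E p (E q u) = E q (E p u).
Proof.
rewrite [in E q u]/cur_act linear_sum [in RHS]/cur_act; apply: eq_bigr => i _.
by rewrite linearZ /= E_e.
Qed.

Lemma h_E j p u : h_ j (E p u) = E p (h_ j u) + 2%:R *: E (t ^+ j * p) u.
Proof.
rewrite E_tXM /cur_act linear_sum scaler_sumr -big_split; apply: eq_bigr => i _ /=.
by rewrite linearZ /= (act_he Hv) scalerDr !scalerA mulrC.
Qed.

(** The action of [h] times [t^j p], with the indices [j + i >= n] kept; it is minus the commutator
    of [f_j] with [E p]. *)
Definition h_shift j p u := \sum_(i < n) p`_i *: h_ (j + i)%N u.

Lemma h_shift_linear j p : linear (h_shift j p).
Proof.
move=> k u w; rewrite /h_shift scaler_sumr -big_split /=.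
by apply: eq_bigr => i _; rewrite linearP scalerDr !scalerA mulrC.
Qed.
HB.instance Definition _ j p :=
  GRing.isLinear.Build C M M _ (h_shift j p) (h_shift_linear j p).

Lemma f_E j p u : f_ j (E p u) = E p (f_ j u) - h_shift j p u.
Proof.
rewrite /h_shift /cur_act linear_sum -sumrB; apply: eq_bigr => i _ /=.
by rewrite linearZ /= (act_fe Hv) scalerBr.
Qed.

Lemma h_shift_E j p q u :
  h_shift j p (E q u) = E q (h_shift j p u) + 2%:R *: E (t ^+ j * (p * q)) u.
Proof.
have -> : E (t ^+ j * (p * q)) u = \sum_(i < n) p`_i *: E (t ^+ (j + i) * q) u.
  rewrite {1}(qpoly_sum n_gt0 p) mulr_suml mulr_sumr cur_act_sum.
  by apply: eq_bigr => i _; rewrite -scalerAl -scalerAr cur_actZ mulrA exprD.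
rewrite /h_shift linear_sum scaler_sumr -big_split /=; apply: eq_bigr => i _.
by rewrite h_E linearZ scalerDr !scalerA [2%:R * _]mulrC.
Qed.

Lemma h_shift_v j p : h_shift j p v = ((j == 0%N)%:R * p`_0 * lam) *: v.
Proof.
rewrite /h_shift (bigD1 (Ordinal n_gt0)) //= big1 => [|i ne].
  by rewrite addr0 addn0 (act_hv Hv) scalerA; congr (_ *: _); ring.
rewrite (act_hv Hv) addn_eq0 (_ : (i == 0 :> nat)%N = false) ?andbF ?mul0r ?scale0r
  ?scaler0 //.
by apply: contraNF ne => /eqP i0; apply/eqP/val_inj.
Qed.

(** * Grading by the length of words and eigenvalues of [h_0] *)

Fixpoint wspace (k : nat) : {vspace M} :=
  if k is k'.+1 then (\sum_(i < n) (e_ i @: wspace k'))%VS else <[v]>%VS.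

Lemma wspace_E k p u : u \in wspace k -> E p u \in wspace k.+1.
Proof.
move=> uk; apply: memv_suml => i _; apply: memvZ.
by apply: (subvP (sumv_sup i _ (subvv _))) => //; apply: memv_img.
Qed.

Lemma wspace_iter k p u : u \in wspace k -> forall m, iter m (E p) u \in wspace (m + k).
Proof. by move=> uk; elim=> //= m IH; apply: wspace_E. Qed.

Lemma wspace_weight k u : u \in wspace k -> h_ 0 u = (lam + 2%:R * k%:R) *: u.
Proof.
elim: k u => [|k IH] u /=.
  by case/vlineP => c ->; rewrite linearZ /= (act_hv Hv) eqxx mul1r mulr0 addr0 scalerA
    mulrC scalerA.
case/memv_sumP => w wk ->; rewrite linear_sum scaler_sumr; apply: eq_bigr => i _.
have /memv_imgP[w' wk' ->] := wk i isT.
rewrite /= (act_he Hv) IH // linearZ -scalerDl; congr (_ *: _).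
by rewrite -natr1; ring.
Qed.

Lemma mword_wspace w : mword act w v \in wspace (size w).
Proof.
elim: w => [|i w IH] /=; first exact: memv_line.
by rewrite -E_tX; apply: wspace_E.
Qed.

(* A polynomial in h_0, playing the role of a projection onto weight spaces. *)
Definition weight_filter (s : seq C) : 'End(M) :=
  foldr (fun mu Q => (h_ 0 - mu *: \1) \o Q)%VF \1%VF s.

Lemma weight_filterE s nu u : h_ 0 u = nu *: u ->
  weight_filter s u = (\prod_(mu <- s) (nu - mu)) *: u.
Proof.
move=> hu; elim: s => [|mu s IH] /=; first by rewrite big_nil scale1r id_lfunE.
rewrite big_cons comp_lfunE IH linearZ /= add_lfunE opp_lfunE scale_lfunE id_lfunE hu.
by rewrite -scalerBl scalerA mulrC.
Qed.

Definition weights (s : seq nat) : seq C := [seq lam + 2%:R * k%:R | k <- s].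

Lemma weight_inj k m : (lam + 2%:R * k%:R - (lam + 2%:R * m%:R) == 0 :> C) = (k == m).
Proof.
rewrite subr_eq0 (inj_eq (addrI _)) (inj_eq (mulfI _)) ?pnatr_eq0 //.
by rewrite eqr_nat.
Qed.

Lemma weight_filter_wspace s k u : u \in wspace k ->
  weight_filter (weights s) u =
    (\prod_(m <- s) (lam + 2%:R * k%:R - (lam + 2%:R * m%:R))) *: u.
Proof. by move=> /wspace_weight/weight_filterE ->; rewrite big_map. Qed.

Lemma weight_filter_kill s k u : u \in wspace k -> k \in s ->
  weight_filter (weights s) u = 0.
Proof.
move=> uk ks; rewrite (weight_filter_wspace _ uk) (big_rem k) //=.
by rewrite subrr mul0r scale0r.
Qed.

Lemma weight_prod_neq0 s k : k \notin s ->
  \prod_(m <- s) (lam + 2%:R * k%:R - (lam + 2%:R * m%:R)) != 0 :> C.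
Proof.
move=> ks; rewrite prodf_seq_neq0; apply/allP => m ms /=.
by rewrite weight_inj; apply: contraNneq ks => ->.
Qed.

(** If [wspace k] is nonzero, so are all the earlier ones; a vector from each gives [k.+1]
    eigenvectors of [h_0] with distinct eigenvalues. Hence [E p] is nilpotent and the truncation in
    [nexp] cuts off only zero terms. *)
Lemma wspace_lt k : wspace k != 0%VS -> (k < \dim {:M})%N.
Proof.
move=> k0.
have nz i : (i <= k)%N -> vpick (wspace i) != 0.
  move=> ik; rewrite vpick0; apply: contraNneq k0 => i0.
  rewrite -(subnK ik); elim: (k - i)%N => [|d IH]; first by rewrite add0n i0.
  by rewrite addSn /= (eqP IH) big1 // => j _; rewrite limg0.
pose X := [tuple vpick (wspace (i : 'I_k.+1)) | i < k.+1].
have Xfree : free X.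
  have XE (j : 'I_k.+1) : X`_j = vpick (wspace j) by rewrite -tnth_nth tnth_mktuple.
  apply/freeP => c c0 i.
  (* The filter on all indices but [i] kills every term of the linear relation except the [i]-th. *)
  have [s sP] : exists s : seq nat, forall j, (j \in s) = (j != i) && (j < k.+1)%N.
    exists (rem (i : nat) (iota 0 k.+1)) => j.
    by rewrite mem_rem_uniq ?iota_uniq // inE mem_iota.
  have := congr1 (weight_filter (weights s)) c0.
  rewrite linear0 linear_sum (bigD1 i) // big1 => [|j ne].
    rewrite XE Monoid.mulm1 linearZ /= (weight_filter_wspace _ (memv_pick _)).
    move/eqP; rewrite !scaler_eq0 (negbTE (nz _ _)) -1?ltnS // orbF.
    by rewrite (negbTE (weight_prod_neq0 _)) ?orbF ?sP ?eqxx // => /eqP.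
  rewrite /= XE linearZ /= (weight_filter_kill (memv_pick _)) ?scaler0 // sP ltn_ord andbT.
  exact: ne.
have := dimvS (subvf <<X>>%VS).
by move: Xfree; rewrite /free => /eqP ->; rewrite size_tuple.
Qed.

Lemma wspace_vanish k u : (\dim {:M} <= k)%N -> u \in wspace k -> u = 0.
Proof.
move=> le uk; have [k0|/wspace_lt] := eqVneq (wspace k) 0%VS; last by rewrite ltnNge le.
by move: uk; rewrite k0 memv0 => /eqP.
Qed.

Lemma v_neq0 : v != 0.
Proof.
apply/eqP => v0; have [] := act_e_free Hv (c0 := 1) (c := fun=> 0).
  by rewrite v0 scaler0 add0r big1 // => i _; rewrite scale0r.
by move/eqP; rewrite oner_eq0.
Qed.

Lemma dim_gt1 : (1 < \dim {:M})%N.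
Proof.
apply: wspace_lt; apply/eqP => W0.
have : e_ 0 v \in wspace 1 by rewrite -E_tX; apply: wspace_E; apply: memv_line.
rewrite W0 memv0 => /eqP e0.
have [] := act_e_free Hv (c0 := 0) (c := fun i : 'I_n => (i == 0%N :> nat)%:R).
  rewrite scale0r add0r (bigD1 (Ordinal n_gt0)) //= e0 scaler0 add0r big1 // => i ne.
  case: eqP => [i0|_]; last by rewrite scale0r.
  by case/eqP: ne; apply: val_inj.
move=> _ /(_ (Ordinal n_gt0)) /eqP; by rewrite oner_eq0.
Qed.

End Current.

Section Cell.
Variables (C : numFieldType) (n : nat).
Hypothesis n_gt0 : (0 < n)%N.
Variables (M : vectType C) (act : 'M[C]_2 -> nat -> 'End(M)) (v : M) (lam : C).
Hypothesis Hv : lowest_current_module n act v lam.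
Local Notation A := {poly %/ ('X^n : {poly C})}.
Local Notation e_ j := (act (sl2_e C) j).
Local Notation h_ j := (act (sl2_h C) j).
Local Notation f_ j := (act (sl2_f C) j).
Local Notation E := (@cur_act C M n act (sl2_e C)).
Local Notation F := (@cur_act C M n act (sl2_f C)).
Local Notation t := (tX C n).
Implicit Types (p q : A) (u : M).
Local Notation D := (\dim {:M}).
Local Notation wspace := (wspace n act v).

(** * Coordinates on the big cell *)

Definition chart_basis : n.+1.-tuple M := [tuple of v :: [tuple e_ i v | i < n]].

Lemma chart_basis0 : chart_basis`_(@ord0 n) = v. Proof. by []. Qed.

Lemma chart_basisS (i : 'I_n) : chart_basis`_(lift ord0 i) = e_ i v.
Proof.
rewrite lift0 /=; have := tnth_mktuple (fun i : 'I_n => e_ i v) i.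
by rewrite (tnth_nth 0).
Qed.

Lemma chart_basis_free : free chart_basis.
Proof.
apply/freeP => c; rewrite big_ord_recl chart_basis0.
under eq_bigr do rewrite chart_basisS.
case/(act_e_free Hv) => c0 cS i.
by have [j ->|->] := unliftP ord0 i.
Qed.

(** It kills the words of length at least 2 and acts by a nonzero scalar on lengths 0 and 1. After
    division by that scalar it yields linear forms on all of [M] that read off the components along
    [v] and the [e_i v]. *)
Definition low_filter := weight_filter act (weights lam (iota 2 D)).
Definition filter_scalar (k : nat) : C :=
  \prod_(m <- iota 2 D) (lam + 2%:R * k%:R - (lam + 2%:R * m%:R)).

Lemma low_filter_kill k u : (1 < k)%N -> u \in wspace k -> low_filter u = 0.
Proof.
move=> k1 uk; have [le|lt] := leqP D k.
  by rewrite (wspace_vanish Hv le uk) linear0.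
by apply: (weight_filter_kill Hv uk); rewrite mem_iota k1 /=; apply: ltn_addl.
Qed.

Lemma low_filterE k u : u \in wspace k -> low_filter u = filter_scalar k *: u.
Proof. exact: weight_filter_wspace. Qed.

Lemma filter_scalar_neq0 k : (k < 2)%N -> filter_scalar k != 0.
Proof. by move=> k2; apply: weight_prod_neq0; rewrite mem_iota leqNgt k2. Qed.

Definition coord_line u : C^o := (filter_scalar 0)^-1 * coord chart_basis ord0
  (low_filter u).

Definition coord_cell u : A := \sum_(i < n)
  ((filter_scalar 1)^-1 * coord chart_basis (lift ord0 i) (low_filter u)) *: t ^+ i.

Lemma coord_line_linear : linear coord_line.
Proof. by move=> k u w; rewrite /coord_line !linearP /= mulrDr mulrCA. Qed.
HB.instance Definition _ := GRing.isLinear.Build C M C^o _ coord_line coord_line_linear.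

Lemma coord_cell_linear : linear coord_cell.
Proof.
move=> k u w; rewrite /coord_cell scaler_sumr -big_split; apply: eq_bigr => i _ /=.
by rewrite !linearP /= mulrDr mulrCA scalerDl scalerA.
Qed.
HB.instance Definition _ := GRing.isLinear.Build C M A _ coord_cell coord_cell_linear.

Lemma v_wspace : v \in wspace 0. Proof. exact: memv_line. Qed.

Lemma coord_v j : coord chart_basis j v = (ord0 == j)%:R.
Proof. by rewrite -[X in coord _ _ X]chart_basis0 coord_free ?chart_basis_free. Qed.

Lemma coord_e (i : 'I_n) j : coord chart_basis j (e_ i v) = (lift ord0 i == j)%:R.
Proof. by rewrite -chart_basisS coord_free ?chart_basis_free. Qed.

Lemma coord_line_v : coord_line v = 1.
Proof.
rewrite /coord_line (low_filterE v_wspace) linearZ /= mulrA mulVf ?filter_scalar_neq0 //.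
by rewrite coord_v mul1r.
Qed.

Lemma coord_cell_v : coord_cell v = 0.
Proof.
rewrite /coord_cell big1 // => i _; rewrite (low_filterE v_wspace) linearZ /=.
by rewrite coord_v !mulr0 scale0r.
Qed.

Lemma coord_line_E p : coord_line (E p v) = 0.
Proof.
rewrite /coord_line (low_filterE (wspace_E _ v_wspace)) linearZ /= linear_sum.
by rewrite big1 ?mulr0 // => i _; rewrite linearZ /= coord_e mulr0.
Qed.

Lemma coord_cell_E p : coord_cell (E p v) = p.
Proof.
rewrite [RHS](qpoly_sum n_gt0); apply: eq_bigr => i _; congr (_ *: _).
rewrite (low_filterE (wspace_E _ v_wspace)) linearZ /= mulrA mulVf ?filter_scalar_neq0 //.
rewrite mul1r linear_sum (bigD1 i) //= big1 => [|j ne].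
  by rewrite linearZ /= coord_e eqxx mulr1 addr0.
by rewrite linearZ /= coord_e (inj_eq lift_inj) (negbTE ne) mulr0.
Qed.

Lemma coord_line_high k u : (1 < k)%N -> u \in wspace k -> coord_line u = 0.
Proof. by move=> k1 uk; rewrite /coord_line (low_filter_kill k1 uk) linear0 mulr0. Qed.

Lemma coord_cell_high k u : (1 < k)%N -> u \in wspace k -> coord_cell u = 0.
Proof.
move=> k1 uk; rewrite /coord_cell big1 // => i _.
by rewrite (low_filter_kill k1 uk) linear0 mulr0 scale0r.
Qed.

Definition cell p : M := nexp (E p) v.

(** The remainder [r] collects the words of length at least 2. Quantifying over [Y] serves both
    coordinate maps, whose targets differ. *)
Lemma cell_split p : exists2 r, cell p = v + E p v + r &
  forall (V : lmodType C) (Y : {linear M -> V}),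
    (forall k u, (1 < k)%N -> u \in wspace k -> Y u = 0) -> Y r = 0.
Proof.
have D1 := dim_gt1 n_gt0 Hv.
rewrite /cell /nexp; case: D D1 => [|[|d]] // _.
rewrite 2!big_ord_recl addrA /= fact0 (_ : 1`! = 1%N) // invr1 !scale1r.
eexists; first by [].
move=> V Y Y0; rewrite linear_sum big1 // => i _; rewrite linearZ /=.
rewrite (Y0 (i.+2)) ?scaler0 //.
by have := wspace_iter p v_wspace i.+2; rewrite addn0.
Qed.

Lemma coord_line_cell p : coord_line (cell p) = 1.
Proof.
have [r -> rP] := cell_split p.
rewrite !linearD /= coord_line_v coord_line_E rP ?addr0 //.
exact: coord_line_high.
Qed.

Lemma coord_cell_cell p : coord_cell (cell p) = p.
Proof.
have [r -> rP] := cell_split p.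
rewrite !linearD /= coord_cell_v coord_cell_E rP ?addr0 ?add0r //.
exact: coord_cell_high.
Qed.

(** The filter on [1, ..., D] maps all of [M] into the line of [v], and it multiplies the
    eigenvector [u] by a nonzero scalar. *)
Lemma lowest_weight_line u : h_ 0 u = lam *: u -> u \in <[v]>%VS.
Proof.
move=> hu; pose s := iota 1 D.
have sub w : weight_filter act (weights lam s) w \in <[v]>%VS.
  apply: (mword_ind Hv (P := fun w => weight_filter act (weights lam s) w \in <[v]>%VS)).
    by rewrite linear0 mem0v.
  move=> c x {}w wP; rewrite linearD linearZ /=; apply: memvD => //; apply: memvZ.
  have xW := mword_wspace n_gt0 Hv x.
  case: (size x) xW => [|k] xW.
    by rewrite (weight_filter_wspace Hv _ xW); apply: memvZ.
  have [le|lt] := leqP D k.+1.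
    by rewrite (wspace_vanish Hv le xW) linear0 mem0v.
  by rewrite (weight_filter_kill Hv xW) ?mem0v // mem_iota /= add1n ltnS ltnW.
have := sub u.
have hu' : h_ 0 u = (lam + 2%:R * 0%:R) *: u by rewrite mulr0 addr0.
rewrite (weight_filterE _ hu') big_map => /(memvZ (_ : C)^-1).
set c := \prod_(_ <- _) _ => /(_ c); rewrite scalerA mulVf ?scale1r //.
by apply: weight_prod_neq0; rewrite mem_iota.
Qed.

(** * Vector fields of the operators on the big cell *)

(** Commuting an operator past the exponential series shortens it, so truncations of several lengths
    occur; by nilpotency those near the dimension agree with [cell], if necessary after applying
    some [E q]. *)
Definition partial_exp m p : M := \sum_(0 <= k < m) (k`!%:R)^-1 *: iter k (E p) v.

Lemma cell_partial p : cell p = partial_exp D.+1 p.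
Proof. by rewrite /cell /nexp /partial_exp big_mkord. Qed.

Lemma iter_wspace k p : iter k (E p) v \in wspace k.
Proof. by have := wspace_iter p v_wspace k; rewrite addn0. Qed.

Lemma partial_exp_full m p : (D <= m <= D.+1)%N -> partial_exp m p = cell p.
Proof.
case/andP => le le'; rewrite cell_partial /partial_exp [in RHS](big_cat_nat (leq0n m)) //=.
rewrite [X in _ + X]big_nat_cond [X in _ + X]big1 ?addr0 // => k /andP[/andP[mk _] _].
by rewrite (wspace_vanish Hv _ (iter_wspace k p)) ?scaler0 // (leq_trans le).
Qed.

Lemma E_partial_exp q m p : (D <= m.+1 <= D.+2)%N -> E q (partial_exp m p) = E q (cell p).
Proof.
case/andP => le le'; rewrite cell_partial /partial_exp [in RHS](big_cat_nat (leq0n m)) //=.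
rewrite linearD -[LHS]addr0; congr (_ + _); rewrite big_nat_cond linear_sum big1 // => k.
case/andP => /andP[mk _] _.
rewrite linearZ /= (wspace_vanish Hv _ (wspace_E q (iter_wspace k p))) ?scaler0 //.
by rewrite (leq_trans le).
Qed.

Lemma E_partial_sum q m p :
  E q (partial_exp m p) = \sum_(0 <= k < m) (k`!%:R)^-1 *: E q (iter k (E p) v).
Proof. by rewrite /partial_exp linear_sum; apply: eq_bigr => k _; rewrite linearZ. Qed.

Lemma exp_shift m (c : nat -> M) :
  \sum_(0 <= k < m.+1) (k`!%:R)^-1 *: (k%:R *: c k.-1) = \sum_(0 <= k < m) (k`!%:R)^-1
    *: c k.
Proof.
rewrite big_nat_recl //= scale0r scaler0 add0r; apply: eq_bigr => k _.
by rewrite scalerA factS natrM invfM mulrAC mulVf ?pnatr_eq0 // mul1r.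
Qed.

Lemma h_iter j p k : h_ j (iter k (E p) v) =
  ((j == 0%N)%:R * lam) *: iter k (E p) v
  + k%:R *: (2%:R *: E (t ^+ j * p) (iter k.-1 (E p) v)).
Proof.
elim: k => [|k IH]; first by rewrite scale0r addr0 (act_hv Hv).
rewrite iterS (h_E n_gt0 Hv) IH linearD linearZ /= -addrA; congr (_ + _).
rewrite linearZ /= [E p (2%:R *: _)]linearZ /= (E_comm Hv) -[k.+1%:R]natr1 [(k%:R + 1)
  *: _]scalerDl scale1r; congr (_ + _).
by case: k {IH} => [|k]; rewrite ?scale0r.
Qed.

Lemma h_cell j p : h_ j (cell p) =
  ((j == 0%N)%:R * lam) *: cell p + 2%:R *: E (t ^+ j * p) (cell p).
Proof.
rewrite {1 2}cell_partial /partial_exp linear_sum.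
pose c (k : nat) := 2%:R *: E (t ^+ j * p) (iter k (E p) v).
rewrite (eq_bigr (fun k => ((j == 0%N)%:R * lam) *: ((k`!%:R)^-1 *: iter k (E p) v)
    + (k`!%:R)^-1 *: (k%:R *: c k.-1))) => [|k _]; last first.
  by rewrite linearZ /= h_iter scalerDr !scalerA [_ * (_ * lam)]mulrC.
rewrite big_split /= -scaler_sumr; congr (_ + _).
rewrite exp_shift.
rewrite -(@E_partial_exp _ D); last by rewrite leqnSn ltnS leqnSn.
rewrite E_partial_sum scaler_sumr; apply: eq_bigr => k _.
by rewrite /c !scalerA mulrC.
Qed.

Lemma h_shift_iter j p k : h_shift act j p (iter k (E p) v) =
  ((j == 0%N)%:R * p`_0 * lam) *: iter k (E p) v
  + k%:R *: (2%:R *: E (t ^+ j * (p * p)) (iter k.-1 (E p) v)).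
Proof.
elim: k => [|k IH]; first by rewrite scale0r addr0 (h_shift_v n_gt0 Hv).
rewrite iterS (h_shift_E n_gt0 Hv) IH linearD linearZ /= -addrA; congr (_ + _).
rewrite linearZ /= [E p (2%:R *: _)]linearZ /= (E_comm Hv) -[k.+1%:R]natr1 [(k%:R + 1)
  *: _]scalerDl scale1r; congr (_ + _).
by case: k {IH} => [|k]; rewrite ?scale0r.
Qed.

Lemma E_scale q (c : C) u : E q (c *: u) = c *: E q u.
Proof. exact: linearZ. Qed.

Lemma E_add q u w : E q (u + w) = E q u + E q w.
Proof. exact: linearD. Qed.

Lemma E_opp q u : E q (- u) = - E q u.
Proof. exact: linearN. Qed.

(** Moving [f_j] to the right leaves an [h] in each of [k] positions; moving these further gives
    [2 E (t^j p^2)] for every pair of positions, in total [k (k - 1)]. For [k = 0] and [k = 1] the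
    truncated predecessors occur with coefficient 0. *)
Lemma f_iter j p k : f_ j (iter k (E p) v) =
  - (k%:R *: (((j == 0%N)%:R * p`_0 * lam) *: iter k.-1 (E p) v
     + k.-1%:R *: E (t ^+ j * (p * p)) (iter k.-2 (E p) v))).
Proof.
set nu := _ * lam; set Y := E (t ^+ j * (p * p)).
elim: k => [|k IH]; first by rewrite scale0r oppr0 (act_fv Hv).
rewrite iterS (f_E Hv) IH h_shift_iter -/nu E_opp E_scale E_add !E_scale (E_comm Hv)
  -/Y -opprD.
congr (- _).
case: k {IH} => [|k] /=; first by rewrite !scale0r !addr0 add0r scale1r.
case: k => [|k] /=.
  by rewrite !scale0r !addr0 scale1r scalerDr !scale1r addrA -mulr2n -scaler_nat.
set a := E p (iter k _ _); set b := E p a.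
rewrite !scalerDr !scalerA addrACA -!scalerDl.
by congr (_ *: _ + _ *: _); rewrite -[k.+3]addn1 -[k.+2]addn1 !natrD; ring.
Qed.

Lemma f_cell j p : f_ j (cell p) =
  - ((j == 0%N)%:R * p`_0 * lam) *: cell p - E (t ^+ j * (p * p)) (cell p).
Proof.
set nu := _ * lam; set Y := E (t ^+ j * (p * p)).
have D1 := dim_gt1 n_gt0 Hv.
pose a k := nu *: iter k (E p) v + k%:R *: Y (iter k.-1 (E p) v).
have -> : f_ j (cell p) = - \sum_(0 <= k < D) (k`!%:R)^-1 *: a k.
  rewrite -exp_shift -sumrN cell_partial /partial_exp linear_sum.
  by apply: eq_bigr => k _; rewrite linearZ /= f_iter scalerN.
rewrite scaleNr -opprD; congr (- _).
rewrite (eq_bigr (fun k => nu *: ((k`!%:R)^-1 *: iter k (E p) v)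
    + (k`!%:R)^-1 *: (k%:R *: Y (iter k.-1 (E p) v)))) => [|k _]; last first.
  by rewrite scalerDr !scalerA [_ * nu]mulrC.
rewrite big_split /= -scaler_sumr -/(partial_exp D p) partial_exp_full ?leqnn ?leqnSn //.
congr (_ + _); rewrite -{1}(prednK (ltnW D1)).
rewrite (exp_shift D.-1 (fun k => Y (iter k (E p) v))) -E_partial_sum E_partial_exp //.
by rewrite prednK ?(ltnW D1) // leqnn (leq_trans (leqnSn _) (leqnSn _)).
Qed.

Section Virasoro.
Variable L : nat -> 'End(M).
Hypothesis L_ops : virasoro_ops act v L.

Lemma L_E j p u : L j (E p u) = E p (L j u) - E (t ^+ j * tderiv p) u.
Proof.
rewrite (E_tXM n_gt0 Hv) /cur_act linear_sum -sumrB; apply: eq_bigr => i _ /=.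
have /eqP := L_ops.2 (sl2_e C) j i u (mxtr_e C); rewrite subr_eq => /eqP Le.
by rewrite coef_tderiv // linearZ /= Le addrC scalerBr scalerA mulrC.
Qed.

Lemma L_iter j p k : L j (iter k (E p) v) =
  - (k%:R *: E (t ^+ j * tderiv p) (iter k.-1 (E p) v)).
Proof.
elim: k => [|k IH]; first by rewrite scale0r oppr0 L_ops.1.
rewrite iterS L_E IH E_opp E_scale (E_comm Hv) -opprD -natr1 scalerDl scale1r.
by case: k {IH} => [|k]; rewrite ?scale0r.
Qed.

Lemma L_cell j p : L j (cell p) = - E (t ^+ j * tderiv p) (cell p).
Proof.
rewrite {1}cell_partial /partial_exp linear_sum.
under eq_bigr do rewrite linearZ /= L_iter scalerN.
rewrite sumrN; congr (- _).
rewrite (exp_shift D (fun k => E (t ^+ j * tderiv p) (iter k (E p) v))).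
rewrite -(@E_partial_exp _ D); last by rewrite leqnSn ltnS leqnSn.
by rewrite E_partial_sum.
Qed.

End Virasoro.
End Cell.

(** * The action of the group *)

Section Group.
Variables (C : numFieldType) (n : nat).
Hypothesis n_gt0 : (0 < n)%N.
Variables (M : vectType C) (act : 'M[C]_2 -> nat -> 'End(M)) (v : M) (lam : C).
Hypothesis Hv : lowest_current_module n act v lam.
Local Notation A := {poly %/ ('X^n : {poly C})}.
Variable rho : 'M[A]_2 -> 'End(M).
Hypothesis rho_act : integrates act rho.
Local Notation e_ j := (act (sl2_e C) j).
Local Notation h_ j := (act (sl2_h C) j).
Local Notation f_ j := (act (sl2_f C) j).
Local Notation E := (@cur_act C M n act (sl2_e C)).
Local Notation F := (@cur_act C M n act (sl2_f C)).
Local Notation t := (tX C n).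
Local Notation D := (\dim {:M}).
Local Notation cell := (@cell C n M act v).
Implicit Types (p q : A) (u : M) (g : 'M[A]_2).

Lemma rhoM g g' u : \det g = 1 -> \det g' = 1 -> rho (g *m g') u = rho g (rho g' u).
Proof. by case: rho_act => _ rM _ _ dg dg'; rewrite rM // comp_lfunE. Qed.

Lemma rho1 u : rho (mx2 1 0 0 1) u = u.
Proof. by case: rho_act => r1 _ _ _; rewrite -mx2_1 r1 id_lfunE. Qed.

Lemma rho_upper p u : rho (mx2 1 p 0 1) u = nexp (E p) u.
Proof. by case: rho_act => _ _ rE _; rewrite -mx2_upper rE. Qed.

Lemma rho_lower p u : rho (mx2 1 0 p 1) u = nexp (F p) u.
Proof. by case: rho_act => _ _ _ rF; rewrite -mx2_lower rF. Qed.

Lemma rho_cell p : cell p = rho (mx2 1 p 0 1) v.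
Proof. by rewrite rho_upper. Qed.

Lemma det_upper p : \det (mx2 1 p 0 1) = 1.
Proof. by rewrite det_mx2 mulr0 mulr1 subr0. Qed.

Lemma det_lower p : \det (mx2 1 0 p 1) = 1.
Proof. by rewrite det_mx2 mul0r mulr1 subr0. Qed.

Lemma rho_inj g u : \det g = 1 -> rho g u = 0 -> u = 0.
Proof.
move=> dg gu0; rewrite -(rho1 u).
have E1 : mx2 1 0 0 1 = \adj g *m g by rewrite mul_adj_mx dg -mx2_1.
rewrite E1 rhoM ?gu0 ?linear0 //.
have := congr1 determinant E1; rewrite det_mulmx dg mulr1 det_mx2 => <-.
by rewrite mulr1 mulr0 subr0.
Qed.

Lemma iter_cur_actZ x (s : C) p k u :
  iter k (cur_act act x (s *: p)) u = s ^+ k *: iter k (cur_act act x p) u.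
Proof.
elim: k => [|k IH]; first by rewrite scale1r.
by rewrite !iterS IH cur_actZ linearZ /= scalerA exprS.
Qed.

Lemma nexp_cur_actZ x (s : C) p u : nexp (cur_act act x (s *: p)) u =
  \sum_(k < D.+1) s ^+ k *: ((k`!%:R)^-1 *: iter k (cur_act act x p) u).
Proof.
by apply: eq_bigr => k _; rewrite iter_cur_actZ !scalerA mulrC.
Qed.

(* Differentiate both sides at [s = 0]. *)
Lemma nexp_intertwine (S : 'End(M)) x y p q :
  (forall (s : C) u, S (nexp (cur_act act x (s *: p)) u)
                     = nexp (cur_act act y (s *: q)) (S u)) ->
  forall u, S (cur_act act x p u) = cur_act act y q (S u).
Proof.
move=> SE u; apply/eqP; rewrite -subr_eq0; apply/eqP.
have SZ (s : C) w : S (s *: w) = s *: S w by rewrite linearZ.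
pose c k := (k`!%:R)^-1 *: (S (iter k (cur_act act x p) u) - iter k (cur_act act y q)
  (S u)).
have c0 (s : C) : s != 0 -> \sum_(k < D.+1) s ^+ k *: c k = 0.
  move=> _; have := SE s u; rewrite !nexp_cur_actZ linear_sum => /eqP.
  rewrite -subr_eq0 -sumrB => /eqP Z; rewrite -[RHS]Z; apply: eq_bigr => k _.
  by rewrite /= !SZ /c -!scalerBr.
have /= := vect_poly_vanish c0 (ltnW (dim_gt1 n_gt0 Hv) : 1 < D.+1)%N.
by rewrite /c (_ : 1`! = 1%N) // invr1 scale1r.
Qed.

Lemma nexp_fix x p u : cur_act act x p u = 0 -> nexp (cur_act act x p) u = u.
Proof.
move=> pu; rewrite /nexp big_ord_recl /= fact0 invr1 scale1r big1 ?addr0 // => k _.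
have -> : cur_act act x p (iter k (cur_act act x p) u) = 0; last by rewrite scaler0.
by rewrite -iterS iterSr pu; elim: (k : nat) => //= m ->; rewrite linear0.
Qed.

Lemma F_v p : F p v = 0.
Proof. by rewrite /cur_act big1 // => i _; rewrite (act_fv Hv) scaler0. Qed.

Lemma rho_lower_v p : rho (mx2 1 0 p 1) v = v.
Proof. by rewrite rho_lower nexp_fix // F_v. Qed.

Lemma FE_v p q : F p (E q v) = - (p`_0 * q`_0 * lam) *: v.
Proof.
rewrite {1}/cur_act (bigD1 (Ordinal n_gt0)) //= big1 => [|i ne].
  by rewrite (f_E Hv) (act_fv Hv) linear0 (h_shift_v n_gt0 Hv) eqxx sub0r addr0 mul1r
    scalerN scalerA -scaleNr mulrA.
rewrite (f_E Hv) (act_fv Hv) linear0 (h_shift_v n_gt0 Hv) (_ : (i == 0 :> nat)%N = false).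
  by rewrite !mul0r scale0r sub0r oppr0 scaler0.
by apply: contraNF ne => /eqP i0; apply/eqP/val_inj.
Qed.

(** * The diagonal torus and the decomposition of the group *)

Section Torus.
Variables d d' : A.
Hypothesis dd' : d * d' = 1.
Local Notation T := (mx2 d' 0 0 d).

Lemma det_torus : \det T = 1.
Proof. by rewrite det_mx2 mulr0 subr0 mulrC. Qed.

Lemma torus_E p u : rho T (E p u) = E (d' ^+ 2 * p) (rho T u).
Proof.
apply: nexp_intertwine => s w; rewrite -!rho_upper -!rhoM ?det_upper ?det_torus //.
rewrite !mx2M; congr (rho (mx2 _ _ _ _) w);
  rewrite ?(mulr0, mul0r, mulr1, mul1r, addr0, add0r) //.
by rewrite -scalerAr -scalerAl; congr (_ *: _);
  rewrite expr2 -!mulrA [p * d]mulrC [d' * (d * p)]mulrA [d' * d]mulrC dd' mul1r.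
Qed.

Lemma torus_F p u : rho T (F p u) = F (d ^+ 2 * p) (rho T u).
Proof.
apply: nexp_intertwine => s w; rewrite -!rho_lower -!rhoM ?det_lower ?det_torus //.
rewrite !mx2M; congr (rho (mx2 _ _ _ _) w);
  rewrite ?(mulr0, mul0r, mulr1, mul1r, addr0, add0r) //.
by rewrite -scalerAr -scalerAl; congr (_ *: _);
  rewrite expr2 -!mulrA [p * d']mulrC [d * (d' * p)]mulrA dd' mul1r.
Qed.

(** [integrates] prescribes [rho] on elementary matrices, so the torus is reached through its
    commutation rules: [rho T v] is killed by [F 1], and computing [F 1 (E 1 (rho T v))] in two ways
    shows that it has weight [lam], which leaves only the line of [v]. *)
Lemma torus_v : exists2 c, c != 0 & rho T v = c *: v.
Proof.
have coef1 : (d' ^+ 2 : {poly C})`_0 * (d ^+ 2 : {poly C})`_0 = 1.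
  by rewrite -coefqM0 // -exprMn mulrC dd' expr1n coefq1.
have hu : h_ 0 (rho T v) = lam *: rho T v.
  have F1 : F 1 (rho T v) = 0.
    have -> : (1 : A) = d ^+ 2 * d' ^+ 2 by rewrite -exprMn dd' expr1n.
    by rewrite -torus_F F_v linear0.
  have FE : F 1 (E 1 (rho T v)) = - lam *: rho T v.
    have -> : E 1 (rho T v) = rho T (E (d ^+ 2) v).
      by rewrite torus_E -exprMn mulrC dd' expr1n.
    have -> : (1 : A) = d ^+ 2 * d' ^+ 2 by rewrite -exprMn dd' expr1n.
    by rewrite -torus_F FE_v coef1 mul1r linearZ.
  have F1f u : F 1 u = f_ 0 u by rewrite -(expr0 t) cur_act_tX.
  move: FE; rewrite F1f (f_E Hv) -F1f F1 linear0 sub0r.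
  rewrite /h_shift (bigD1 (Ordinal n_gt0)) //= big1 => [|i ne].
    by rewrite coefq1 // eqxx scale1r addr0 scaleNr => /oppr_inj.
  rewrite coefq1 // (_ : (i == 0 :> nat)%N = false) ?scale0r //.
  by apply: contraNF ne => /eqP i0; apply/eqP/val_inj.
have /vlineP[c cE] := lowest_weight_line n_gt0 Hv hu.
exists c => //; apply: contraTneq isT => c0; move: cE; rewrite c0 scale0r.
by move/(rho_inj det_torus)/eqP; rewrite (negbTE (v_neq0 Hv)).
Qed.

End Torus.

(** Gauss decomposition into upper, diagonal and lower factors: the lower one fixes [v] and the
    diagonal one rescales it, so the point depends only on the quotient of the second column. *)
Lemma rho_column a b c d d' : \det (mx2 a b c d) = 1 -> d * d' = 1 ->
  exists2 k, k != 0 & rho (mx2 a b c d) v = k *: cell (b * d').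
Proof.
move=> dg dd'; have [k k0 kE] := torus_v dd'; exists k => //.
have d'd : d' * d = 1 by rewrite mulrC.
have -> : mx2 a b c d = mx2 1 (b * d') 0 1 *m (mx2 d' 0 0 d *m mx2 1 0 (c * d') 1).
  rewrite det_mx2 in dg; rewrite !mx2M ?(mulr0, mul0r, mulr1, mul1r, addr0, add0r).
  congr mx2.
  - transitivity (a * d * d'); first by rewrite -mulrA dd' mulr1.
    have -> : a * d = 1 + b * c by rewrite -dg subrK.
    have -> : b * d' * (d * (c * d')) = b * c * d' * (d * d') by ring.
    by rewrite dd'; ring.
  - by rewrite -mulrA d'd mulr1.
  - by rewrite mulrCA dd' mulr1.
rewrite !rhoM ?det_upper ?det_lower ?(det_torus dd') //; last first.
  by rewrite det_mulmx (det_torus dd') det_lower mulr1.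
by rewrite rho_lower_v kE linearZ /= rho_cell.
Qed.

Lemma rho_flip q q' : q * q' = 1 ->
  exists2 k, k != 0 & rho (mx2 0 (-1) 1 0) (cell q) = k *: cell (- q').
Proof.
move=> qq'.
have ds : \det (mx2 (0 : A) (-1) 1 0) = 1.
  by rewrite det_mx2 mulr0 mulr1 sub0r opprK.
have -> : rho (mx2 0 (-1) 1 0) (cell q) = rho (mx2 0 (-1) 1 q) v.
  rewrite rho_cell -rhoM ?det_upper //; congr (rho _ v); rewrite mx2M.
  by congr mx2; rewrite ?mul0r ?mulr0 ?mul1r ?mulr1 ?add0r ?addr0.
have dg : \det (mx2 0 (-1) 1 q) = 1 by rewrite det_mx2 mul0r mulr1 sub0r opprK.
by have [k k0 ->] := rho_column dg qq'; exists k; rewrite // mulN1r.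
Qed.

Lemma flip_E p u : E p (rho (mx2 0 (-1) 1 0) u) = - rho (mx2 0 (-1) 1 0) (F p u).
Proof.
have ds : \det (mx2 (0 : A) (-1) 1 0) = 1.
  by rewrite det_mx2 mulr0 mulr1 sub0r opprK.
rewrite -[p in LHS]opprK -scaleN1r cur_actZ scaleN1r; congr (- _); symmetry.
apply: nexp_intertwine => s w; rewrite -rho_lower -rho_upper -!rhoM ?det_upper
  ?det_lower //.
rewrite !mx2M; congr (rho (mx2 _ _ _ _) w);
  rewrite ?(mulr0, mul0r, mulr1, mul1r, addr0, add0r) //.
by rewrite mulN1r scalerN.
Qed.

End Group.

(** * Forms and jets *)

Section MpolyCurve.
Variables (C : fieldType) (m : nat) (c : 'I_m -> {poly C}).

(** Substitution of a polynomial curve, with the chain rule for the linear coefficient. It links the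
    formal [mderiv] with coefficients of polynomials in one variable. *)
Definition curve_jet (F : {mpoly C[m]}) := exists P : {poly C},
  (forall s, F.@[fun i => (c i).[s]] = P.[s]) /\
  P`_1 = \sum_i (mderiv i F).@[fun j => (c j)`_0] * (c i)`_1.

Lemma curve_jet0 (F : {mpoly C[m]}) (P : {poly C}) :
  (forall s, F.@[fun i => (c i).[s]] = P.[s]) -> P`_0 = F.@[fun j => (c j)`_0].
Proof.
move=> FP; rewrite -horner_coef0 -FP; apply: meval_eq => i.
by rewrite horner_coef0.
Qed.

Lemma curve_jetD F G : curve_jet F -> curve_jet G -> curve_jet (F + G).
Proof.
case=> P [FP P1] [Q [GQ Q1]]; exists (P + Q); split=> [s|].
  by rewrite mevalD FP GQ hornerD.
rewrite coefD P1 Q1 -big_split; apply: eq_bigr => i _ /=.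
by rewrite mderivD mevalD mulrDl.
Qed.

Lemma curve_jetM F G : curve_jet F -> curve_jet G -> curve_jet (F * G).
Proof.
case=> P [FP P1] [Q [GQ Q1]]; exists (P * Q); split=> [s|].
  by rewrite mevalM FP GQ hornerM.
have -> : (P * Q)`_1 = P`_1 * Q`_0 + P`_0 * Q`_1 by rewrite coefM big_ord_recl big_ord1
  addrC.
rewrite P1 Q1 (curve_jet0 FP) (curve_jet0 GQ) mulr_suml mulr_sumr -big_split;
  apply: eq_bigr => i _ /=.
by rewrite mderivM mevalD !mevalM; ring.
Qed.

Lemma curve_jetC k : curve_jet k%:MP.
Proof.
exists k%:P; split=> [s|]; first by rewrite mevalC hornerC.
by rewrite coefC big1 // => i _; rewrite mderivC meval0 mul0r.
Qed.

Lemma curve_jetX i : curve_jet 'X_i.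
Proof.
exists (c i); split=> [s|]; first by rewrite mevalXU.
rewrite (bigD1 i) //= big1 ?addr0 => [|j ne].
  rewrite mderivX mnm1E eqxx scale1r (_ : (U_(i) - U_(i))%MM = 0%MM).
    by rewrite mpolyX0 meval1 mul1r.
  by apply/mnmP => k; rewrite mnmBE subnn mnm0E.
by rewrite mderivX mnm1E eq_sym (negbTE ne) scale0r meval0 mul0r.
Qed.

Lemma curve_jetP F : curve_jet F.
Proof.
elim/mpolyind: F => [|k mm F _ _ IH]; first by rewrite -mpolyC0; apply: curve_jetC.
apply: curve_jetD => //; rewrite -mul_mpolyC; apply: curve_jetM; first exact: curve_jetC.
rewrite mpolyXE_id; elim/big_rec: _ => [|i F' _ IH']; first by rewrite -mpolyC1;
  apply: curve_jetC.
apply: curve_jetM => //; elim: (mm i) => [|e IHe].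
  by rewrite expr0 -mpolyC1; apply: curve_jetC.
by rewrite exprS; apply: curve_jetM => //; apply: curve_jetX.
Qed.

End MpolyCurve.

Section Forms.
Variables (C : fieldType) (M : vectType C).
Local Notation D := (\dim {:M}).
Local Notation b := (vbasis {:M}).

Lemma basis_expand (x : M) : x = \sum_i coord b i x *: b`_i.
Proof. exact/coord_vbasis/memvf. Qed.

Lemma coord_eq (x y : M) : (forall i, coord b i x = coord b i y) -> x = y.
Proof.
by move=> xy; rewrite (basis_expand x) (basis_expand y); apply: eq_bigr => i _; rewrite xy.
Qed.

Lemma peval_line (F : {mpoly C[D]}) (x w : M) : exists P : {poly C},
  (forall s, peval F (x + s *: w) = P.[s]) /\ P`_1 = pdiff F x w.
Proof.
have [P [FP P1]] := curve_jetP (fun i => (coord b i x)%:P + coord b i w *: 'X) F.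
exists P; split=> [s|].
  rewrite -FP; apply: meval_eq => i.
  by rewrite linearD linearZ /= hornerD hornerC hornerZ hornerX mulrC.
rewrite P1; apply: eq_bigr => i _; rewrite coefD coefC coefZ coefX mulr1 add0r.
congr (_ * _); apply: meval_eq => j.
by rewrite coefD coefC coefZ coefX mulr0 addr0.
Qed.

(** [Zariski_closure] tests homogeneous polynomials in fixed coordinates; this predicate recognizes
    functions given by formulas as such. *)
Definition isform d (phi : M -> C) := exists2 F : {mpoly C[D]},
  F \is d.-homog & forall x, peval F x = phi x.

Lemma isform_ext d phi psi : phi =1 psi -> isform d phi -> isform d psi.
Proof. by move=> e [F Fh FE]; exists F => // x; rewrite FE e. Qed.

Lemma isform0 d : isform d (fun=> 0).
Proof. by exists 0 => [|x]; [apply: dhomog0 | apply: meval0]. Qed.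

Lemma isformD d phi psi : isform d phi -> isform d psi -> isform d (fun x => phi x + psi x).
Proof.
case=> F Fh FE [G Gh GE]; exists (F + G) => [|x]; first exact: dhomogD.
by rewrite /peval mevalD -FE -GE.
Qed.

Lemma isformZ d k phi : isform d phi -> isform d (fun x => k * phi x).
Proof.
case=> F Fh FE; exists (k *: F) => [|x]; first exact: dhomogZ.
by rewrite /peval mevalZ -FE.
Qed.

Lemma isformN d phi : isform d phi -> isform d (fun x => - phi x).
Proof. by move/(isformZ (-1)); apply: isform_ext => x; rewrite mulN1r. Qed.

Lemma isformM d e phi psi : isform d phi -> isform e psi ->
  isform (d + e) (fun x => phi x * psi x).
Proof.
case=> F Fh FE [G Gh GE]; exists (F * G) => [|x]; first exact: dhomogM.
by rewrite /peval mevalM -FE -GE.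
Qed.

Lemma isform1 : isform 0 (fun=> 1).
Proof. by exists 1 => [|x]; [apply: dhomog1 | apply: meval1]. Qed.

Lemma isformX d phi k : isform d phi -> isform (k * d) (fun x => phi x ^+ k).
Proof.
move=> H; elim: k => [|k IH]; first exact: isform1.
by rewrite mulSn; apply: (isform_ext _ (isformM H IH)) => x; rewrite exprS.
Qed.

Lemma isform_sum d I (r : seq I) (phi : I -> M -> C) : (forall i, isform d (phi i)) ->
  isform d (fun x => \sum_(i <- r) phi i x).
Proof.
move=> H; elim: r => [|i r IH].
  by apply: isform_ext (isform0 d) => x; rewrite big_nil.
by apply: isform_ext (isformD (H i) IH) => x; rewrite big_cons.
Qed.

Lemma isform_coord i : isform 1 (coord b i).
Proof.
exists 'X_i => [|x]; last exact: mevalXU.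
by rewrite dhomogX /= mdeg1.
Qed.

Lemma isform_linear (phi : {linear M -> C^o}) : isform 1 phi.
Proof.
have H : isform 1 (fun x => \sum_(i < D) phi b`_i * coord b i x).
  by apply: isform_sum => i; apply/isformZ/isform_coord.
apply: isform_ext H => x; rewrite [in RHS](basis_expand x) linear_sum.
by apply: eq_bigr => i _; rewrite linearZ mulrC.
Qed.

Lemma isform_peval d (F : {mpoly C[D]}) : F \is d.-homog -> isform d (peval F).
Proof. by exists F. Qed.

Lemma peval_scale d (F : {mpoly C[D]}) (c : C) x : F \is d.-homog ->
  peval F (c *: x) = c ^+ d * peval F x.
Proof.
move=> Fh; rewrite /peval !mevalE mulr_sumr !big_seq; apply: eq_bigr => mm mmF.
rewrite mulrCA; congr (_ * _); rewrite -(dhomog_mf Fh mmF) /= mdegE.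
elim: (index_enum _) => [|i r IH]; first by rewrite !big_nil mul1r.
rewrite !big_cons IH linearZ exprMn exprD; ring.
Qed.

Lemma isform_comp d (phi : M -> C) (B : 'End(M)) :
  isform d phi -> isform d (fun x => phi (B x)).
Proof.
case=> F Fh FE; pose coord_comp i : {linear M -> C^o} := (coord b i \o B)%FUN.
pose psi x := \sum_(mm <- msupp F) F@_mm * \prod_i coord b i (B x) ^+ mm i.
have H : isform d psi.
  rewrite /psi; elim: (msupp F) (dhomog_mf Fh) => [|mm r IH] hr.
    by apply: isform_ext (isform0 d) => x; rewrite big_nil.
  have Hm : isform d (fun x => \prod_i coord b i (B x) ^+ mm i).
    rewrite -(hr mm (mem_head _ _)) /= mdegE.
    elim: (index_enum _) => [|i s IHs].
      rewrite big_nil; apply: (isform_ext _ isform1) => x; by rewrite big_nil.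
    rewrite big_cons -[mm i]muln1.
    apply: isform_ext (isformM (isformX (mm i) (isform_linear (coord_comp i))) IHs) => x.
    by rewrite big_cons.
  have IHr := IH (fun m' m'r => hr m' (@mem_behead _ (mm :: r) m' m'r)).
  by apply: isform_ext (isformD (isformZ (F@_mm) Hm) IHr) => x; rewrite big_cons.
by apply: isform_ext H => x; rewrite -FE /peval mevalE.
Qed.

(** The degree is written [d.-1 + 1] to cover [d = 0], where the partial derivatives vanish and
    count as forms of any degree. *)
Lemma isform_pdiff d (F : {mpoly C[D]}) (T : 'End(M)) : F \is d.-homog ->
  isform (d.-1 + 1) (fun x => pdiff F x (T x)).
Proof.
move=> Fh; apply: isform_sum => i; apply: isformM; last first.
  exact: (isform_linear (coord b i \o T)%FUN).
apply: isform_peval; apply/dhomogP => mm; rewrite mcoeff_msupp mcoeff_mderiv => nz.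
have : (mm + U_(i))%MM \in msupp F.
  by rewrite mcoeff_msupp; apply: contraNneq nz => ->; rewrite mul0rn.
by move/(dhomog_mf Fh) => <- /=; rewrite mdegD mdeg1 addn1.
Qed.

End Forms.

Section Jets.
Variables (C : fieldType) (W : lmodType C).

(* Lines through 0 suffice, as [rigidity] compares only the maps s |-> G (s *: p). *)
Definition jet (F : W -> C) := exists2 DF : W -> C,
  (forall k x y, DF (k *: x + y) = k * DF x + DF y) &
  forall b, exists P : {poly C}, (forall s, F (s *: b) = P.[s]) /\ P`_1 = DF b.

Lemma jet_ext F G : F =1 G -> jet F -> jet G.
Proof.
move=> FG [DF lin H]; exists DF => // b; have [P [PF P1]] := H b.
by exists P; split=> // s; rewrite -FG.
Qed.

Lemma jet_const k : jet (fun=> k).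
Proof.
exists (fun=> 0) => [c x y|b]; first by rewrite mulr0 addr0.
by exists k%:P; split=> [s|]; rewrite ?hornerC ?coefC.
Qed.

Lemma jet_linear (phi : {linear W -> C^o}) : jet phi.
Proof.
exists phi => [k x y|b]; first exact: linearP.
exists (phi b *: 'X); split=> [s|]; first by rewrite linearZ hornerZ hornerX mulrC.
by rewrite coefZ coefX mulr1.
Qed.

Lemma jet0 (F : W -> C) b (P : {poly C}) : (forall s, F (s *: b) = P.[s]) -> P`_0 = F 0.
Proof. by move=> /(_ 0); rewrite scale0r horner_coef0. Qed.

Lemma coefM1 (P Q : {poly C}) : (P * Q)`_1 = P`_1 * Q`_0 + P`_0 * Q`_1.
Proof. by rewrite coefM big_ord_recl big_ord1 addrC. Qed.

Lemma jetD F G : jet F -> jet G -> jet (fun w => F w + G w).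
Proof.
case=> DF lF HF [DG lG HG]; exists (fun b => DF b + DG b) => [k x y|b].
  by rewrite lF lG; ring.
have [P [PF P1]] := HF b; have [Q [QG Q1]] := HG b.
by exists (P + Q); split=> [s|]; rewrite ?hornerD ?PF ?QG // coefD P1 Q1.
Qed.

Lemma jetM F G : jet F -> jet G -> jet (fun w => F w * G w).
Proof.
case=> DF lF HF [DG lG HG]; exists (fun b => DF b * G 0 + F 0 * DG b) => [k x y|b].
  by rewrite lF lG; ring.
have [P [PF P1]] := HF b; have [Q [QG Q1]] := HG b.
exists (P * Q); split=> [s|]; first by rewrite hornerM PF QG.
by rewrite coefM1 P1 Q1 (jet0 PF) (jet0 QG).
Qed.

Lemma jet_sum I (r : seq I) (F : I -> W -> C) : (forall i, jet (F i)) ->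
  jet (fun w => \sum_(i <- r) F i w).
Proof.
move=> H; elim: r => [|i r IH].
  by apply: jet_ext (jet_const 0) => w; rewrite big_nil.
by apply: jet_ext (jetD (H i) IH) => w; rewrite big_cons.
Qed.

Lemma jet_meval m (F : {mpoly C[m]}) (f : 'I_m -> W -> C) : (forall i, jet (f i)) ->
  jet (fun w => F.@[fun i => f i w]).
Proof.
move=> H; elim/mpolyind: F => [|k mm F _ _ IH].
  by apply: jet_ext (jet_const 0) => w; rewrite meval0.
have Hm : jet (fun w => \prod_i f i w ^+ mm i).
  elim: (index_enum _) => [|i r IHr].
    by apply: jet_ext (jet_const 1) => w; rewrite big_nil.
  apply: jet_ext (jetM (_ : jet (fun w => f i w ^+ mm i)) IHr) => [w|].
    by rewrite big_cons.
  elim: (mm i) => [|e IHe]; first exact: jet_const.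
  by apply: jet_ext (jetM (H i) IHe) => w; rewrite exprS.
apply: jet_ext (jetD (jetM (jet_const k) Hm) IH) => w.
by rewrite mevalD mevalZ mevalX.
Qed.

Section Vector.
Variable M : vectType C.
Local Notation b := (vbasis {:M}).

Definition vjet (f : W -> M) := forall i, jet (fun w => coord b i (f w)).

Lemma vjet_const x : vjet (fun=> x).
Proof. by move=> i; apply: jet_const. Qed.

Lemma vjet_form f (phi : {linear M -> C^o}) : vjet f -> jet (fun w => phi (f w)).
Proof.
move=> Hf; apply: (@jet_ext (fun w => \sum_i coord b i (f w) * phi b`_i)).
  by move=> w; rewrite [in RHS](basis_expand (f w)) linear_sum; apply: eq_bigr => i _;
    rewrite linearZ.
by apply: jet_sum => i; apply: jetM => //; apply: jet_const.
Qed.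

Lemma vjet_linear f (S : {linear M -> M}) : vjet f -> vjet (fun w => S (f w)).
Proof. by move=> Hf i; apply: (vjet_form (coord b i \o S)%FUN Hf). Qed.

Lemma vjetZ (F : W -> C) f : jet F -> vjet f -> vjet (fun w => F w *: f w).
Proof.
by move=> HF Hf i; apply: jet_ext (jetM HF (Hf i)) => w; rewrite linearZ.
Qed.

Lemma vjet_sum I (r : seq I) (f : I -> W -> M) : (forall i, vjet (f i)) ->
  vjet (fun w => \sum_(i <- r) f i w).
Proof.
move=> H i; apply: jet_ext (jet_sum r (fun k => H k i)) => w.
by rewrite linear_sum.
Qed.

Lemma jet_peval (F : {mpoly C[\dim {:M}]}) f : vjet f -> jet (fun w => peval F (f w)).
Proof. by move=> Hf; apply: jet_meval. Qed.

Lemma vjet_cur_act n (act : 'M[C]_2 -> nat -> 'End(M)) x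
    (a : W -> {poly %/ ('X^n : {poly C})}) f :
  (forall j, jet (fun w => (a w : {poly C})`_j)) -> vjet f ->
  vjet (fun w => cur_act act x (a w) (f w)).
Proof.
by move=> Ha Hf; apply: vjet_sum => j; apply: vjetZ => //; apply: vjet_linear.
Qed.

Lemma vjet_nexp n (act : 'M[C]_2 -> nat -> 'End(M)) x
    (a : W -> {poly %/ ('X^n : {poly C})}) f :
  (forall j, jet (fun w => (a w : {poly C})`_j)) -> vjet f ->
  vjet (fun w => nexp (cur_act act x (a w)) (f w)).
Proof.
move=> Ha Hf; apply: vjet_sum => k; apply: vjetZ; first exact: jet_const.
elim: (k : nat) => [|j IH]; first exact: Hf.
exact: (vjet_cur_act act x Ha IH).
Qed.

End Vector.
End Jets.

Lemma jet_id (C : fieldType) : jet (fun s : C^o => s).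
Proof.
exists id => [//|b]; exists (b *: 'X); split=> [s|]; last by rewrite coefZ coefX mulr1.
by rewrite hornerZ hornerX mulrC.
Qed.

(** * Functions without poles on the affine line *)

Section NoPole.
Variable C : numClosedFieldType.

(** One presentation is reduced to lowest terms. If its denominator were not constant it would have
    a root [r], the field being closed; cross-multiplying with the presentation valid at [r] makes
    the numerator vanish there too, against coprimality. *)
Lemma no_pole (G : C -> C) :
  (forall s0, exists N Q : {poly C}, Q.[s0] != 0 /\
    forall s, Q.[s] != 0 -> Q.[s] * G s = N.[s]) ->
  exists P : {poly C}, forall s, G s = P.[s].
Proof.
move=> H; have [N [Q [Q0 HQ]]] := H 0.
have Qn0 : Q != 0 by apply: contraNneq Q0 => ->; rewrite horner0.
pose d := gcdp N Q.
have d0 : d != 0 by rewrite gcdp_eq0 negb_and Qn0 orbT.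
have Nd : N = N %/ d * d by rewrite divpK ?dvdp_gcdl.
have Qd : Q = Q %/ d * d by rewrite divpK ?dvdp_gcdr.
have cop : coprimep (N %/ d) (Q %/ d) by rewrite coprimep_div_gcd ?Qn0 ?orbT.
have cross r : exists N1 Q1 : {poly C}, [/\ Q1.[r] != 0,
    Q1.[r] * G r = N1.[r] & N %/ d * Q1 = N1 * (Q %/ d)].
  have [N1 [Q1 [Q1r H1]]] := H r; exists N1, Q1; split=> //; first exact: H1.
  have Q1n0 : Q1 != 0 by apply: contraNneq Q1r => ->; rewrite horner0.
  apply: (mulIf d0); rewrite mulrAC -Nd -mulrA -Qd; apply/eqP; rewrite -subr_eq0; apply/eqP.
  apply: (@poly_vanish _ _ (Q * Q1)); first by rewrite mulf_neq0.
  move=> s; rewrite hornerM mulf_eq0 negb_or => /andP[Qs Q1s].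
  by rewrite hornerD hornerN !hornerM -(HQ s) // -(H1 s) //; ring.
have Q1 : size (Q %/ d) == 1%N.
  apply: contraT => /closed_rootP[r Qr].
  have [N1 [Q1 [Q1r _ /(congr1 (fun P => P.[r]))]]] := cross r.
  rewrite !hornerM (rootP Qr) mulr0 => /eqP; rewrite mulf_eq0 (negbTE Q1r) orbF => Nr.
  by have := coprimep_root cop Nr; rewrite (rootP Qr) eqxx.
have [c c0 Qc] := size_poly1P _ Q1.
exists (c^-1 *: (N %/ d)) => s; have [N1 [Q1' [Q1s Gs]]] := cross s.
move/(congr1 (fun P => P.[s])); rewrite !hornerM Qc hornerC -Gs hornerZ => E.
apply: (mulfI Q1s); apply: (mulIf c0); rewrite -E; field.
exact: c0.
Qed.

(** On each line [no_pole] applies. The linear term follows by the quotient rule from the single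
    presentation at 0, and is therefore linear in the direction. *)
Lemma jet_no_pole (W : lmodType C) (G : W -> C) :
  (forall w0, exists N Q : W -> C, [/\ jet N, jet Q, Q w0 != 0 &
     forall w, Q w != 0 -> Q w * G w = N w]) ->
  jet G.
Proof.
move=> H; have [N [Q [[DN lN HN] [DQ lQ HQ] Q0 QG]]] := H 0.
exists (fun b => (DN b - G 0 * DQ b) / Q 0) => [k x y|b].
  by rewrite lN lQ; ring.
have [P PG] : exists P : {poly C}, forall s, G (s *: b) = P.[s].
  apply: no_pole => s0; have [N1 [Q1 [[DN1 _ HN1] [DQ1 _ HQ1] Q1s QG1]]] := H (s0 *: b).
  have [P1 [PN _]] := HN1 b; have [R1 [RQ _]] := HQ1 b.
  by exists P1, R1; rewrite -RQ; split=> // s; rewrite -RQ -PN; apply: QG1.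
exists P; split=> //; have [P1 [PN <-]] := HN b; have [R1 [RQ <-]] := HQ b.
have R0 : R1`_0 = Q 0 by apply: jet0 RQ.
suff -> : P1 = P * R1 by rewrite coefM1 R0 (jet0 PG) addrK mulfK.
apply/eqP; rewrite -subr_eq0; apply/eqP; apply: (@poly_vanish _ _ R1).
  by apply: contraNneq Q0 => R10; rewrite -R0 R10 coef0.
move=> s; rewrite -RQ => Qs; rewrite hornerD hornerN hornerM -PN -RQ -PG -QG //.
by ring.
Qed.

End NoPole.

(** * The Schubert variety *)

Section Geometry.
Variables (C : numFieldType) (n : nat).
Hypothesis n_gt0 : (0 < n)%N.
Variables (M : vectType C) (act : 'M[C]_2 -> nat -> 'End(M)) (v : M) (lam : C).
Hypothesis Hv : lowest_current_module n act v lam.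
Local Notation A := {poly %/ ('X^n : {poly C})}.
Variable rho : 'M[A]_2 -> 'End(M).
Hypothesis rho_act : integrates act rho.
Local Notation e_ j := (act (sl2_e C) j).
Local Notation E := (@cur_act C M n act (sl2_e C)).
Local Notation F_ := (@cur_act C M n act (sl2_f C)).
Local Notation t := (tX C n).
Local Notation D := (\dim {:M}).
Local Notation b := (vbasis {:M}).
Local Notation cell := (@cell C n M act v).
Local Notation X := (schubert rho v).
Implicit Types (p q : A) (u x w : M) (g : 'M[A]_2) (F : {mpoly C[D]}).

Lemma orbit_schubert g : \det g = 1 -> X (rho g v).
Proof.
move=> dg; split; last by move=> d F _; apply; exists g.
by apply: contraNneq (v_neq0 Hv) => /(rho_inj rho_act dg) ->.
Qed.

Lemma cell_schubert p : X (cell p).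
Proof. by rewrite (rho_cell v rho_act); apply/orbit_schubert/det_upper. Qed.

(** A curve that passes through [u] at [s = 0]; started at a point of the orbit, it lies for all but
    finitely many [s] over cell points with a unit coordinate. *)
Lemma vjet_orbit_curve u : vjet (fun s : C^o =>
  nexp (E (s *: 1)) (nexp (F_ (s *: 1)) u)).
Proof.
have J j : jet (fun s : C^o => (s *: (1 : A) : {poly C})`_j).
  apply: (@jet_ext _ _ (fun s : C^o => s * (1 : A)`_j)) => [s|]; first by rewrite coefqZ.
  exact: (jetM (jet_id C) (jet_const C^o (1 : A)`_j)).
by apply: vjet_nexp => //; apply: vjet_nexp => //; apply: vjet_const.
Qed.

Lemma schubert_dense d F : F \is d.-homog ->
  (forall p q, p * q = 1 -> peval F (cell p) = 0) -> forall x, X x -> peval F x = 0.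
Proof.
move=> Fh F0 x [_ Xx]; apply: (Xx _ _ Fh) => _ [g [dg ->]].
pose y (s : C) := nexp (E (s *: 1)) (nexp (F_ (s *: 1)) (rho g v)).
have [_ _ /(_ 1)[P [FP _]]] := jet_peval F (vjet_orbit_curve (rho g v)).
have {}FP s : peval F (y s) = P.[s] by rewrite -FP (_ : s *: (1 : C^o) = s) //;
  apply: mulr1.
have <- : y 0 = rho g v.
  by rewrite /y !scale0r -(rho_upper rho_act) -(rho_lower rho_act) !(rho1 rho_act).
rewrite FP; suff -> : P = 0 by rewrite horner0.
(* The constant terms of the second column of [g], not both zero because [\det g = 1]. *)
pose b0 := (g 0 1 : {poly C})`_0; pose d0 := (g 1 1 : {poly C})`_0.
have bd : (b0 != 0) || (d0 != 0).
  apply: contraT; rewrite negb_or !negbK => /andP[/eqP b00 /eqP d00].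
  have /eqP := congr1 (fun p : A => (p : {poly C})`_0) dg.
  rewrite {1}(mx2E g) det_mx2 coefqD.
  have -> (p : A) : (- p : {poly C})`_0 = - p`_0 by rewrite -scaleN1r coefqZ mulN1r.
  rewrite !coefqM0 // -/b0 -/d0 b00 d00 mulr0 mul0r oppr0 addr0 coefq1 //.
  by rewrite eq_sym oner_eq0.
(* As functions of [s], these are the constant terms of the second column after the group element of
   the curve has acted. Where [Q1] is nonzero the point is in the cell; where [Q2] is nonzero too,
   its coordinate is a unit. *)
pose Q1 : {poly C} := d0%:P + b0 *: 'X.
pose Q2 : {poly C} := b0%:P + d0 *: 'X + b0 *: 'X^2.
have Q1n : Q1 != 0.
  apply: contraTneq bd => Q10; rewrite negb_or !negbK.
  have := congr1 (fun P : {poly C} => P`_0) Q10;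
    have := congr1 (fun P : {poly C} => P`_1) Q10.
  by rewrite /= /Q1 !coefD !coefC !coefZ !coefX /= !mulr0 mulr1 addr0 add0r => -> ->;
    rewrite eqxx.
have Q2n : Q2 != 0.
  apply: contraTneq bd => Q10; rewrite negb_or !negbK.
  have := congr1 (fun P : {poly C} => P`_0) Q10;
    have := congr1 (fun P : {poly C} => P`_1) Q10.
  rewrite /= /Q2 !coefD !coefC !coefZ !coefX !coefXn /= !mulr0 mulr1 !addr0 add0r => -> ->.
  by rewrite eqxx.
apply: (@poly_vanish _ _ (Q1 * Q2)); first by rewrite mulf_neq0.
move=> s; rewrite hornerM mulf_eq0 negb_or => /andP[Q1s Q2s]; rewrite -FP.
pose dd : A := g 1 1 + s *: g 0 1; pose bb : A := g 0 1 + s *: dd.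
have dd0 : (dd : {poly C})`_0 != 0.
  by move: Q1s; rewrite /Q1 hornerD hornerC hornerZ hornerX /dd coefqD coefqZ mulrC.
have bb0 : (bb : {poly C})`_0 != 0.
  move: Q2s; rewrite /Q2 !hornerD hornerC !hornerZ hornerX hornerXn /bb /dd coefqD
    coefqZ coefqD coefqZ.
  by rewrite -/b0 -/d0; congr (_ != 0); ring.
have [dd' ddE] := qpoly_unit n_gt0 dd0; have [bb' bbE] := qpoly_unit n_gt0 bb0.
have [a [c [dg' yE]]] : exists a c, \det (mx2 a bb c dd) = 1 /\ y s = rho (mx2 a bb c dd) v.
  pose g' := mx2 1 (s *: 1) 0 1 *m (mx2 1 0 (s *: 1) 1 *m g).
  have dg' : \det g' = 1 by rewrite !det_mulmx det_upper det_lower dg !mulr1.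
  have ys : y s = rho g' v.
    rewrite !(rhoM rho_act) ?det_upper ?det_mulmx ?det_lower ?dg ?mulr1 //.
    by rewrite (rho_upper rho_act) (rho_lower rho_act).
  move: dg' ys; rewrite /g' (mx2E g) !mx2M.
  rewrite !(mulr0, mul0r, mul1r, addr0, add0r) -!scalerAl !mul1r.
  rewrite [s *: g 0 1 + _]addrC -/dd -/bb => dg' ys.
  by do 2!eexists; split; [exact: dg' | exact: ys].
have [k k0 kE] := rho_column n_gt0 Hv rho_act dg' ddE.
rewrite yE kE (peval_scale _ _ Fh) (F0 _ (dd * bb')) ?mulr0 //.
have -> : bb * dd' * (dd * bb') = (bb * bb') * (dd * dd') by ring.
by rewrite bbE ddE mulr1.
Qed.

Lemma form_dense d (phi : M -> C) : isform d phi ->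
  (forall p q, p * q = 1 -> phi (cell p) = 0) -> forall x, X x -> phi x = 0.
Proof.
case=> F Fh FE phi0 x Xx; rewrite -FE; apply: (schubert_dense Fh) Xx => p q pq.
by rewrite FE (phi0 p q).
Qed.

Lemma form_orbit d (phi : M -> C) : isform d phi ->
  (forall g, \det g = 1 -> phi (rho g v) = 0) -> forall x, X x -> phi x = 0.
Proof.
case=> F Fh FE phi0 x [_ Xx]; rewrite -FE; apply: (Xx _ _ Fh) => _ [g [dg ->]].
by rewrite FE phi0.
Qed.

Lemma pdiffD F x (k : C) u w : pdiff F x (k *: u + w) = k * pdiff F x u + pdiff F x w.
Proof.
rewrite /pdiff mulr_sumr -big_split; apply: eq_bigr => i _ /=.
by rewrite linearP mulrDr mulrCA.
Qed.

Lemma pdiff_euler d F x : F \is d.-homog -> peval F x = 0 -> pdiff F x x = 0.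
Proof.
move=> Fh Fx; have [P [FP <-]] := peval_line F x x.
suff -> : P = 0 by rewrite coef0.
apply: poly_vanish0 => s _; rewrite -FP -{1}[x]scale1r -scalerDl.
by rewrite (peval_scale _ _ Fh) Fx mulr0.
Qed.

(** The curve [nexp (E (s *: q)) (cell p)] is [cell (s *: q + p)], so it stays in the variety and
    [F] vanishes along it. *)
Lemma pdiff_E F p q : (forall x, X x -> peval F x = 0) ->
  pdiff F (cell p) (E q (cell p)) = 0.
Proof.
move=> F0; set x := cell p.
pose c i := \poly_(k < D.+1) ((k`!%:R)^-1 * coord b i (iter k (E q) x)).
have [P [FP P1]] := curve_jetP c F.
have D1 := dim_gt1 n_gt0 Hv.
have : P`_1 = 0.
  suff -> : P = 0 by rewrite coef0.
  apply: poly_vanish0 => s _; rewrite -FP.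
  rewrite -(F0 (rho (mx2 1 (s *: q + p) 0 1) v)); last exact/orbit_schubert/det_upper.
  have -> : rho (mx2 1 (s *: q + p) 0 1) v = nexp (E (s *: q)) x.
    rewrite /x (rho_cell v rho_act) -(rho_upper rho_act) -(rhoM rho_act) ?det_upper // mx2M.
    by congr (rho (mx2 _ _ _ _) v); rewrite ?(mulr0, mul0r, mulr1, mul1r, addr0, add0r)
      // addrC.
  apply: meval_eq => i; rewrite horner_poly nexp_cur_actZ linear_sum.
  by apply: eq_bigr => k _; rewrite !linearZ /= mulrC.
rewrite P1 => <-; apply: eq_bigr => i _; congr (_ * _).
  by apply: meval_eq => j; rewrite coef_poly /= fact0 invr1 mul1r.
by rewrite coef_poly ltnS ltnW // (_ : 1`! = 1%N) // invr1 mul1r.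
Qed.

(** For fixed [F] the tangency condition is itself a form in the point, so density reduces it to the
    cell, where [T] moves along the cell up to rescaling. *)
Lemma op_tangent (T : 'End(M)) :
  (forall p, exists (r : A) mu, T (cell p) = E r (cell p) + mu *: cell p) ->
  vf_tangent X (op_field T).
Proof.
move=> HT d F Fh F0; apply: (form_dense (isform_pdiff T Fh)) => p q _.
have [r [mu ->]] := HT p; rewrite addrC pdiffD (pdiff_E _ _ F0) addr0.
by rewrite (pdiff_euler Fh) ?mulr0 //; apply/F0/cell_schubert.
Qed.

Lemma op_regular (T : 'End(M)) : vf_regular X (op_field T).
Proof.
move=> x0 _.
have H (i : 'I_D) : exists P, P \is 1.-homog /\ forall x, peval P x = coord b i (T x).
  by have [P Ph PE] := isform_linear (coord b i \o T)%FUN; exists P.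
have [P HP] := fin_all_exists H; exists 0%N, 1, P; split.
- exact: dhomog1.
- by move=> i; case: (HP i).
- by rewrite /peval meval1 oner_eq0.
move=> x _ _; exists 0; rewrite scale0r addr0 /peval meval1 invr1 scale1r.
by rewrite /op_field [LHS]basis_expand; apply: eq_bigr => i _; case: (HP i) => _ <-.
Qed.

Lemma op_vector_field (T : 'End(M)) :
  (forall p, exists (r : A) mu, T (cell p) = E r (cell p) + mu *: cell p) ->
  vector_field X (op_field T).
Proof.
move=> HT; split; [|exact: op_tangent | exact: op_regular].
by move=> x c _ _; exists 0; rewrite /op_field linearZ scale0r addr0.
Qed.

(** * Equations of the variety and its tangent vectors *)

Local Notation y0 := (@coord_line C n M act v lam).
Local Notation yh := (@coord_cell C n M act v lam).

Lemma coord_cur_act i (x : 'M[C]_2) p u : coord b i (cur_act act x p u) =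
  \sum_(j < n) p`_j * \sum_(l < D) coord b l u * coord b i (act x j b`_l).
Proof.
rewrite linear_sum; apply: eq_bigr => j _; rewrite linearZ; congr (_ * _).
by rewrite [in LHS](basis_expand u) !linear_sum; apply: eq_bigr => l _; rewrite !linearZ.
Qed.

Lemma iter_form k i : isform k (fun z => coord b i (iter k (E (yh z)) v)).
Proof.
elim: k i => [|k IH] i /=.
  apply: isform_ext (isformZ (coord b i v) (isform1 M)) => z; exact: mulr1.
pose yc j z : C := (yh z : {poly C})`_j.
have Hy j : isform 1 (yc j).
  have lin : linear (yc j : M -> C^o).
    by move=> c x w; rewrite /yc linearP coefqD coefqZ.
  pose yl : {linear M -> C^o} := HB.pack (yc j) (GRing.isLinear.Build C M C^o _ _ lin).
  exact: (isform_linear yl).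
pose a z := \sum_(j < n) \sum_(l < D)
  coord b i (e_ j b`_l) * (yc j z * coord b l (iter k (E (yh z)) v)).
apply: (@isform_ext _ _ _ a) => [z|].
  rewrite coord_cur_act; apply: eq_bigr => j _; rewrite mulr_sumr.
  by apply: eq_bigr => l _; rewrite /yc; ring.
apply: isform_sum => j; apply: isform_sum => l; apply: isformZ; rewrite -add1n.
exact: isformM.
Qed.

(* On the cone over the big cell, z is proportional to [cell (yh z / y0 z)]. *)
Definition cell_equation i z : C := y0 z ^+ D.-1 * coord b i z
  - \sum_(k < D.+1) y0 z ^+ (D - k) * ((k`!%:R)^-1 * coord b i (iter k (E (yh z)) v)).

(** Multiplying [z = y0 z *: cell ((y0 z)^-1 *: yh z)] by [y0 z ^+ D.-1] clears all denominators and
    puts every term in degree [D]. *)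
Lemma cell_equation_form i : isform D (cell_equation i).
Proof.
have D1 := ltnW (dim_gt1 n_gt0 Hv).
have Hy : isform 1 y0 by apply: isform_linear.
apply: (isformD (psi := fun z => - _)).
  have H := isformM (isformX D.-1 Hy) (isform_coord i).
  by rewrite muln1 addn1 prednK // in H.
apply: isformN; apply: isform_sum => k.
have H := isformM (isformX (D - k) Hy) (isformZ (k`!%:R)^-1 (iter_form k i)).
by rewrite muln1 subnK // -ltnS in H.
Qed.

Lemma cell_equation0 i x : X x -> cell_equation i x = 0.
Proof.
apply: (form_dense (cell_equation_form i)) => p q _.
rewrite /cell_equation (coord_line_cell n_gt0 Hv) (coord_cell_cell n_gt0 Hv).
rewrite expr1n mul1r {1}/cell /nexp linear_sum; apply/eqP; rewrite subr_eq0.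
by apply/eqP; apply: eq_bigr => k _; rewrite expr1n mul1r linearZ.
Qed.

Lemma coef_linear_exp (a : C) m :
  ((1 + a *: 'X) ^+ m)`_0 = 1 /\ ((1 + a *: 'X) ^+ m)`_1 = m%:R * a.
Proof.
elim: m => [|m [IH0 IH1]]; first by rewrite expr0 !coefC mul0r.
rewrite exprS coefM1 IH0 IH1 -!horner_coef0 hornerM !horner_coef0 IH0.
rewrite !coefD !coefC !coefZ !coefX /= mulr0 mulr1 add0r addr0 mul1r mulr1.
by split=> //; rewrite -natr1; ring.
Qed.

(** The cell equations pulled back by [B] vanish on the variety, so their differentials at [x] kill
    [w]. With [u = B w], their linear part at [v] says that [(D - 1) y0(u) v + u] equals
    [D y0(u) v + E (yh u) v]. *)
Lemma tangent_cell (B : 'End(M)) x w :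
  (forall g, \det g = 1 -> exists2 g', \det g' = 1 & B (rho g v) = rho g' v) ->
  X x -> B x = v ->
  (forall d F, F \is d.-homog -> (forall y, X y -> peval F y = 0) -> pdiff F x w = 0) ->
  B w = y0 (B w) *: v + E (yh (B w)) v.
Proof.
move=> BS Xx Bx Tw; apply: coord_eq => i.
set u := B w; pose a := y0 u; pose om := yh u.
have [G Gh GE] := isform_comp B (cell_equation_form i).
have G0 y : X y -> peval G y = 0.
  move=> Xy; rewrite GE.
  apply: (form_orbit (isform_comp B (cell_equation_form i))) Xy => g dg.
  have [g' dg' ->] := BS g dg; exact/cell_equation0/orbit_schubert.
have [P [GP P1]] := peval_line G x w.
move: P1; rewrite (Tw _ _ Gh G0) => P1.
(* The restriction of [y0] to the line [v + s u]; on the same line [yh] is [s om]. *)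
pose V := 1 + a *: 'X : {poly C}.
pose c k := (k`!%:R)^-1 * coord b i (iter k (E om) v).
pose R : {poly C} := V ^+ D.-1 * ((coord b i v)%:P + coord b i u *: 'X)
  - \sum_(k < D.+1) V ^+ (D - k) * (c k *: 'X^k).
have PR : P = R.
  apply/eqP; rewrite -subr_eq0; apply/eqP; apply: poly_vanish0 => s _.
  rewrite hornerD hornerN -GP GE linearD linearZ /= Bx -/u.
  have VE : V.[s] = y0 (v + s *: u).
    rewrite linearD linearZ /= (coord_line_v Hv) /V hornerD hornerC hornerZ hornerX.
    by rewrite mulrC.
  have yE : yh (v + s *: u) = s *: om.
    by rewrite linearD linearZ /= (coord_cell_v Hv) add0r.
  rewrite /cell_equation /R hornerD hornerN hornerM horner_exp VE yE.
  have -> : coord b i (v + s *: u) = coord b i v + coord b i u * s.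
    by rewrite linearD linearZ /= [s * _]mulrC.
  rewrite hornerD hornerC hornerZ hornerX.
  rewrite horner_sum opprD opprK addrACA subrr add0r.
  apply/eqP; rewrite addrC subr_eq0; apply/eqP; apply: eq_bigr => k _.
  rewrite hornerM horner_exp VE hornerZ hornerXn iter_cur_actZ linearZ /= /c; ring.
move: P1; rewrite PR /R coefD coefN coefM1 !coefD !coefC !coefZ !coefX /=.
rewrite mulr0 !mulr1 addr0 add0r.
have [V0 V1] := coef_linear_exp a D.-1; rewrite V0 V1 mul1r.
have -> : (\sum_(k < D.+1) V ^+ (D - k) * (c k *: 'X^k))`_1 = D%:R * a * c 0%N + c 1%N.
  rewrite coef_sum; have D1 := dim_gt1 n_gt0 Hv.
  have coefV (k : nat) : (V ^+ (D - k) * (c k *: 'X^k))`_1 =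
      if k is 0%N then D%:R * a * c 0%N else if k is 1%N then c 1%N else 0.
    rewrite -scalerAr coefZ coefMXn; case: k => [|[|k]] /=; last by rewrite mulr0.
      by rewrite subn0 (coef_linear_exp a D).2 mulrC.
    by rewrite (coef_linear_exp a _).1 mulr1.
  under eq_bigr do rewrite coefV.
  have sum01 m (y z : C) : (0 < m)%N ->
      \sum_(k < m.+1) (if k : nat is 0%N then y else if k : nat is 1%N then z else 0) =
        y + z.
    by case: m => // m _; rewrite 2!big_ord_recl big1 ?addr0.
  exact/sum01/ltnW.
rewrite /c fact0 (_ : 1`! = 1%N) // invr1 !mul1r.
rewrite linearD linearZ /= -/a -/om => /eqP; rewrite subr_eq0 addrC => /eqP H.
have D1 := ltnW (dim_gt1 n_gt0 Hv).
move: H; rewrite -[X in X%:R * a * _](prednK D1) -natr1 => H.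
by apply: (addrI (D.-1%:R * a * coord b i v)); rewrite [LHS]addrC H; ring.
Qed.

End Geometry.

(** * Vector fields *)

Section JetsLine.
Variables (C : numFieldType) (n : nat).
Hypothesis n_gt0 : (0 < n)%N.
Local Notation A := {poly %/ ('X^n : {poly C})}.

Definition qcoef j (p : A) : C^o := (p : {poly C})`_j.

Lemma qcoef_linear j : linear (qcoef j).
Proof. by move=> k p q; rewrite /qcoef coefqD coefqZ. Qed.
HB.instance Definition _ j := GRing.isLinear.Build C A C^o _ (qcoef j) (qcoef_linear j).

(** The coordinatewise polynomials over the scalars are assembled into one polynomial over A, as
    [rigidity] requires. *)
Lemma jets_line (G : A -> A) : (forall j, jet (fun p => (G p : {poly C})`_j)) ->
  exists g1 : {linear A -> A}, forall p, exists P : {poly A},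
    (forall s : C, G (s *: p) = P.[s%:A]) /\ P`_1 = g1 p.
Proof.
move=> H.
have H' (j : 'I_n) : exists DG : A -> C, (forall k x y, DG (k *: x + y) = k * DG x + DG
  y) /\
    forall b, exists P : {poly C}, (forall s, (G (s *: b) : {poly C})`_j = P.[s]) /\
      P`_1 = DG b.
  by have [DG lin HG] := H j; exists DG.
have {H'} [DG HDG] := fin_all_exists H'.
pose g1 p : A := \sum_(j < n) DG j p *: tX C n ^+ j.
have g1_linear : linear g1.
  move=> k x y; rewrite /g1 scaler_sumr -big_split; apply: eq_bigr => j _ /=.
  by case: (HDG j) => -> _; rewrite scalerDl scalerA.
pose g1l : {linear A -> A} := HB.pack g1 (GRing.isLinear.Build C A A _ _ g1_linear).
exists g1l => p.
have H2 (j : 'I_n) : exists P : {poly C},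
    (forall s, (G (s *: p) : {poly C})`_j = P.[s]) /\ P`_1 = DG j p.
  by case: (HDG j) => _ /(_ p).
have {H2} [P HP] := fin_all_exists H2.
exists (\sum_(j < n) tX C n ^+ j *: map_poly (in_alg A) (P j)); split=> [s|].
  rewrite (qpoly_sum n_gt0 (G _)) horner_sum; apply: eq_bigr => j _.
  case: (HP j) => -> _; rewrite hornerZ -[s%:A]/(in_alg A s) horner_map /=.
  by rewrite mulr_algr.
rewrite coef_sum /= /g1; apply: eq_bigr => j _; case: (HP j) => _ <-.
by rewrite coefZ coef_map /= mulr_algr.
Qed.

End JetsLine.

Section Fields.
Variables (C : numClosedFieldType) (n : nat).
Hypothesis n_gt0 : (0 < n)%N.
Variables (M : vectType C) (act : 'M[C]_2 -> nat -> 'End(M)) (v : M) (lam : C).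
Hypothesis Hv : lowest_current_module n act v lam.
Local Notation A := {poly %/ ('X^n : {poly C})}.
Variable rho : 'M[A]_2 -> 'End(M).
Hypothesis rho_act : integrates act rho.
Local Notation e_ j := (act (sl2_e C) j).
Local Notation h_ j := (act (sl2_h C) j).
Local Notation f_ j := (act (sl2_f C) j).
Local Notation E := (@cur_act C M n act (sl2_e C)).
Local Notation F_ := (@cur_act C M n act (sl2_f C)).
Local Notation t := (tX C n).
Local Notation D := (\dim {:M}).
Local Notation b := (vbasis {:M}).
Local Notation cell := (@cell C n M act v).
Local Notation X := (schubert rho v).
Local Notation y0 := (@coord_line C n M act v lam).
Local Notation yh := (@coord_cell C n M act v lam).
Implicit Types (p q : A) (u x w : M) (g : 'M[A]_2) (F : {mpoly C[D]}).

Lemma E_nexp p q u : E q (nexp (E p) u) = nexp (E p) (E q u).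
Proof.
rewrite /nexp linear_sum; apply: eq_bigr => k _; rewrite linearZ; congr (_ *: _).
by elim: (k : nat) => //= m <-; rewrite (E_comm Hv).
Qed.

Lemma cell_back p : rho (mx2 1 (- p) 0 1) (cell p) = v.
Proof.
rewrite (rho_cell v rho_act) -(rhoM rho_act) ?det_upper // mx2M.
rewrite !(mulr0, mul0r, mulr1, mul1r, addr0, add0r) subrr; exact: (rho1 rho_act).
Qed.

Lemma cell_back_E p q : rho (mx2 1 (- p) 0 1) (E q (cell p)) = E q v.
Proof. by rewrite (rho_upper rho_act) -E_nexp -(rho_upper rho_act) cell_back. Qed.

Lemma E_mul_sum (r : A) p u : E (r * p) u = \sum_(i < n) r`_i *: E (t ^+ i * p) u.
Proof.
rewrite {1}(qpoly_sum n_gt0 r) mulr_suml cur_act_sum; apply: eq_bigr => i _.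
by rewrite -scalerAl cur_actZ.
Qed.

Lemma sum_h_cell (r : A) p : exists k,
  \sum_(i < n) (r`_i / 2%:R) *: h_ i (cell p) = E (r * p) (cell p) + k *: cell p.
Proof.
exists (\sum_(i < n) r`_i / 2%:R * ((i == 0 :> nat)%:R * lam)).
rewrite E_mul_sum scaler_suml -big_split; apply: eq_bigr => i _ /=.
rewrite (h_cell n_gt0 Hv) addrC scalerDr !scalerA; congr (_ *: _ + _).
by rewrite mulfVK // pnatr_eq0.
Qed.

Lemma F_cell (r : A) p : exists k, F_ r (cell p) = k *: cell p - E (r * (p * p)) (cell p).
Proof.
exists (\sum_(i < n) r`_i * - ((i == 0 :> nat)%:R * p`_0 * lam)).
rewrite E_mul_sum scaler_suml -sumrB; apply: eq_bigr => i _ /=.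
by rewrite (f_cell n_gt0 Hv) scalerBr !scalerA.
Qed.

(** * A vector field in a translated chart *)

Section Pulled.
Variables (eta : M -> M) (g0 g1 : 'M[A]_2).
Hypotheses (Heta : vector_field X eta) (dg0 : \det g0 = 1) (dg1 : \det g1 = 1).
Hypotheses (g10 : g1 *m g0 = 1%:M) (g01 : g0 *m g1 = 1%:M).

Lemma rhoK u : rho g1 (rho g0 u) = u.
Proof. by rewrite -(rhoM rho_act) // g10 mx2_1 (rho1 rho_act). Qed.

Lemma rhoKr u : rho g0 (rho g1 u) = u.
Proof. by rewrite -(rhoM rho_act) // g01 mx2_1 (rho1 rho_act). Qed.

(** The value of [eta] at the chart point [rho g0 (cell p)], transported to [v] by the group element
    that brings this point back. The charts used are [g0 = 1] and [g0 = flip]. *)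
Definition pulled_field p : M := rho (mx2 1 (- p) 0 1) (rho g1 (eta (rho g0 (cell p)))).
Definition field_coord p : A := yh (pulled_field p).

Lemma rho_cell_schubert p : X (rho g0 (cell p)).
Proof.
rewrite (rho_cell v rho_act) -(rhoM rho_act) ?det_upper //.
by apply: (orbit_schubert Hv rho_act); rewrite det_mulmx dg0 det_upper mulr1.
Qed.

Lemma field_coordP p : exists a,
  eta (rho g0 (cell p)) = rho g0 (E (field_coord p) (cell p) + a *: cell p).
Proof.
case: Heta => _ Teta _; pose B := (rho (mx2 1 (- p) 0 1) \o rho g1)%VF.
have BE u : B u = rho (mx2 1 (- p) 0 1) (rho g1 u) by rewrite comp_lfunE.
exists (y0 (pulled_field p)).
have := @tangent_cell C n n_gt0 M act v lam Hv rho rho_act B (rho g0 (cell p)) (eta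
  (rho g0 (cell p))).
rewrite !BE rhoK cell_back -/(pulled_field p) => H.
have {H} WE : pulled_field p = y0 (pulled_field p) *: v + E (field_coord p) v.
  apply: H => //; last by move=> d F Fh F0; apply: (Teta d) => //; apply: rho_cell_schubert.
    move=> g dg; exists (mx2 1 (- p) 0 1 *m (g1 *m g)).
      by rewrite !det_mulmx det_upper dg1 dg !mulr1.
    by rewrite BE !(rhoM rho_act) ?det_mulmx ?det_upper ?dg1 ?dg ?mulr1.
  exact: rho_cell_schubert.
have up u : rho (mx2 1 p 0 1) (rho (mx2 1 (- p) 0 1) u) = u.
  rewrite -(rhoM rho_act) ?det_upper // mx2M.
  by rewrite !(mulr0, mul0r, mulr1, mul1r, addr0, add0r) addNr (rho1 rho_act).
have := congr1 (fun u => rho g0 (rho (mx2 1 p 0 1) u)) WE.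
rewrite {1}/pulled_field /= up rhoKr => ->; congr (rho g0 _).
by rewrite addrC linearD linearZ /= -(rho_cell v rho_act) (rho_upper rho_act) -E_nexp.
Qed.

Lemma field_coord_uniq p (r : A) a :
  eta (rho g0 (cell p)) = rho g0 (E r (cell p) + a *: cell p) -> field_coord p = r.
Proof.
move=> etaE; rewrite /field_coord /pulled_field etaE rhoK linearD linearZ /=.
rewrite cell_back_E cell_back linearD linearZ /= (coord_cell_v Hv) scaler0 addr0.
exact: coord_cell_E.
Qed.

Lemma vjet_cell : vjet (fun p => cell p).
Proof.
apply: (@vjet_nexp _ _ _ _ act (sl2_e C) id) => [j|]; last exact: vjet_const.
exact: (jet_linear (qcoef j : {linear A -> C^o})).
Qed.

(** A local presentation of [eta], transported to [v], presents the coordinate as a quotient of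
    jets: the undetermined multiple of the point becomes a multiple of [v], which [yh] kills. *)
Lemma field_coord_jet j : jet (fun p => (field_coord p : {poly C})`_j).
Proof.
case: Heta => _ _ Reta; apply: jet_no_pole => p0.
have [d [q [P [qh Ph q0 qE]]]] := Reta _ (rho_cell_schubert p0).
have Jc : vjet (fun p => rho g0 (cell p)) by apply: vjet_linear vjet_cell.
pose V p := \sum_i peval (P i) (rho g0 (cell p)) *: b`_i.
exists (fun p => (qcoef j \o yh) (nexp (E (- p)) (rho g1 (V p)))).
exists (fun p => peval q (rho g0 (cell p))); split => //.
- apply: vjet_form; apply: vjet_nexp => [i|].
    exact: (jet_linear (qcoef i \o -%R : {linear A -> C^o})).
  apply: vjet_linear; apply: vjet_sum => i; apply: vjetZ; last exact: vjet_const.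
  exact: jet_peval.
- exact: jet_peval.
move=> p qp; rewrite /field_coord /pulled_field.
have [c ->] := qE _ (rho_cell_schubert p) qp; set Q := peval q _ in qp *.
have -> : rho (mx2 1 (- p) 0 1) (rho g1 (Q^-1 *: V p + c *: rho g0 (cell p))) =
    Q^-1 *: nexp (E (- p)) (rho g1 (V p)) + c *: v.
  have lD g u w : rho g (u + w) = rho g u + rho g w by rewrite linearD.
  have lZ g k u : rho g (k *: u) = k *: rho g u by rewrite linearZ.
  by rewrite !lD !lZ rhoK cell_back -(rho_upper rho_act).
set w := nexp _ _; rewrite -[RHS]/((yh w : {poly C})`_j).
have -> : yh (Q^-1 *: w + c *: v) = Q^-1 *: yh w.
  by rewrite linearD !linearZ /= (coord_cell_v Hv) scaler0 addr0.
by rewrite coefqZ mulrA mulfV // mul1r.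
Qed.

End Pulled.

Definition flip : 'M[A]_2 := mx2 0 (-1) 1 0.
Definition flip_inv : 'M[A]_2 := mx2 0 1 (-1) 0.

Lemma det_flip : \det flip = 1.
Proof. by rewrite det_mx2 mulr0 mulr1 sub0r opprK. Qed.
Lemma det_flip_inv : \det flip_inv = 1.
Proof. by rewrite det_mx2 mulr0 mulrN1 sub0r opprK. Qed.
Lemma flipK : flip_inv *m flip = 1%:M.
Proof.
by rewrite mx2M mx2_1 !(mulr0, mul0r, mulr1, mul1r, addr0, add0r) mulrN1 opprK.
Qed.
(** [flip] takes the cell point [q] to the cell point [p], up to a scalar, and turns [E r] into
    minus [F_ r]; on the cell [F_ r] is [- r q^2], so the two signs cancel. *)
Lemma field_coord_flip eta p q : vector_field X eta -> p * q = -1 ->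
  field_coord eta flip flip_inv q = q ^+ 2 * field_coord eta 1%:M 1%:M p.
Proof.
move=> Heta pq; have [Hh _ _] := Heta.
have qq' : q * - p = 1 by rewrite mulrN mulrC pq opprK.
have [k k0 kE] := rho_flip n_gt0 Hv rho_act qq'; rewrite opprK -/flip in kE.
have [a aE] := @field_coordP eta 1%:M 1%:M Heta (det1 _ _) (det1 _ _) (mul1mx _)
  (mul1mx _) p.
have id1 u : rho 1%:M u = u by rewrite mx2_1 (rho1 rho_act).
rewrite !id1 in aE; set r := field_coord _ 1%:M _ _ in aE *.
have [c cE] := Hh (cell p) k (cell_schubert Hv rho_act p) k0.
have [m mE] := F_cell r q.
apply: (@field_coord_uniq eta flip flip_inv det_flip det_flip_inv flipK q _ (a - m + c
  / k)).
rewrite kE cE aE; set Z := rho flip (cell q) in kE *.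
have -> : cell p = k^-1 *: Z by rewrite kE scalerA mulVf // scale1r.
have ErZ : E r Z = rho flip (E (q ^+ 2 * r) (cell q)) - m *: Z.
  by rewrite /Z (flip_E n_gt0 Hv rho_act) mE linearB linearZ opprB expr2 mulrC.
have -> s : rho flip (E (q ^+ 2 * r) (cell q) + s *: cell q)
    = rho flip (E (q ^+ 2 * r) (cell q)) + s *: Z by rewrite linearD linearZ.
rewrite E_scale scalerDr !scalerA mulfV // scale1r ErZ [k * a]mulrC mulfK // scalerDl
  scalerBl.
by rewrite !addrA; congr (_ + _); rewrite addrAC.
Qed.

Lemma field_quadratic eta : vector_field X eta -> exists al be ga de : A,
  forall p q, p * q = 1 -> exists a, eta (cell p) =
    E (al + be * p + ga * p ^+ 2 + de * tderiv p) (cell p) + a *: cell p.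
Proof.
move=> Heta.
have [g1 G_line] := jets_line n_gt0 (field_coord_jet Heta (det1 _ _) (det1 _ _) (mul1mx
  _) ).
have [gt1 Gt_line] := jets_line n_gt0 (field_coord_jet Heta det_flip det_flip_inv flipK).
have [al [be [ga [de H]]]] := rigidity n_gt0 G_line Gt_line (fun p q =>
  field_coord_flip Heta).
exists al, be, ga, de => p q pq; rewrite -(H p q pq).
have [a aE] := @field_coordP eta 1%:M 1%:M Heta (det1 _ _) (det1 _ _) (mul1mx _)
  (mul1mx _) p.
have id1 u : rho 1%:M u = u by rewrite mx2_1 (rho1 rho_act).
by exists a; rewrite !id1 in aE.
Qed.

Section Basis.
Variable L : nat -> 'End(M).
Hypothesis L_ops : virasoro_ops act v L.

Definition field_op (k : 'I_n + 'I_n + 'I_n + 'I_n.-1) : 'End(M) :=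
  match k with
  | inl (inl (inl i)) => e_ i
  | inl (inl (inr i)) => h_ i
  | inl (inr i) => f_ i
  | inr i => L i
  end.

Lemma field_op_cell k p : exists (r : A) mu,
  field_op k (cell p) = E r (cell p) + mu *: cell p.
Proof.
case: k => [[[i|i]|i]|i] /=.
- by exists (t ^+ i), 0; rewrite (E_tX n_gt0 Hv) scale0r addr0.
- exists (2%:R *: (t ^+ i * p)), ((i == 0 :> nat)%:R * lam).
  by rewrite (h_cell n_gt0 Hv) cur_actZ addrC.
- exists (- (t ^+ i * (p * p))), (- ((i == 0 :> nat)%:R * p`_0 * lam)).
  by rewrite (f_cell n_gt0 Hv) -[in RHS]scaleN1r cur_actZ scaleN1r addrC.
- exists (- (t ^+ i * tderiv p)), 0.
  by rewrite (L_cell n_gt0 Hv L_ops) -[in RHS]scaleN1r cur_actZ scaleN1r scale0r addr0.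
Qed.

Lemma sum_field_op (c : 'I_n + 'I_n + 'I_n + 'I_n.-1 -> C) u :
  \sum_k c k *: field_op k u =
    \sum_(i < n) c (inl (inl (inl i))) *: e_ i u
    + \sum_(i < n) c (inl (inl (inr i))) *: h_ i u
    + \sum_(i < n) c (inl (inr i)) *: f_ i u
    + \sum_(i < n.-1) c (inr i) *: L i u.
Proof. by rewrite !big_sumType. Qed.

(** The values of [tderiv] are multiples of [t]. Hence [L_(n-1)] would give the zero field, and the
    list of the [L_i] ends at [n - 2]. *)
Lemma tX_top_tderiv p : t ^+ n.-1 * tderiv p = 0.
Proof.
have [q ->] : exists q, tderiv p = t * q.
  by apply: qpoly_tX_factor => //; rewrite coef_tderiv // mul0r.
by rewrite mulrA -exprSr prednK // tX_nilp // mul0r.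
Qed.

Lemma E_tderiv_sum (r : A) p u :
  E (r * tderiv p) u = \sum_(i < n.-1) r`_i *: E (t ^+ i * tderiv p) u.
Proof.
rewrite E_mul_sum [RHS](big_ord_widen n (fun i => r`_i *: E (t ^+ i * tderiv p) u))
  ?leq_pred //.
rewrite [RHS]big_mkcond; apply: eq_bigr => i _; case: ltnP => // le.
have -> : (i : nat) = n.-1 by apply/eqP; rewrite eqn_leq le -ltnS prednK ?ltn_ord.
by rewrite tX_top_tderiv cur_act0 scaler0.
Qed.

Lemma combination_on_cell (al be ga de : A) : exists c : 'I_n + 'I_n + 'I_n + 'I_n.-1 -> C,
  forall p, exists a, E (al + be * p + ga * p ^+ 2 + de * tderiv p) (cell p) =
    \sum_k c k *: field_op k (cell p) + a *: cell p.
Proof.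
(* On the cell [h_i] is [2 t^i p], whence the halves, while [f_i] and [L_i] carry minus signs; the
   top coefficient of [de] acts by 0. *)
exists (fun k : 'I_n + 'I_n + 'I_n + 'I_n.-1 => match k with
  | inl (inl (inl i)) => al`_i
  | inl (inl (inr i)) => be`_i / 2%:R
  | inl (inr i) => - ga`_i
  | inr i => - de`_i
  end) => p.
have [a1 H1] := sum_h_cell be p; have [a2 H2] := F_cell ga p.
exists (a2 - a1); rewrite sum_field_op H1.
have -> : \sum_(i < n) - ga`_i *: f_ i (cell p) = - F_ ga (cell p).
  by rewrite /cur_act -sumrN; apply: eq_bigr => i _; rewrite scaleNr.
have -> : \sum_(i < n.-1) - de`_i *: L i (cell p) = E (de * tderiv p) (cell p).
  rewrite E_tderiv_sum; apply: eq_bigr => i _.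
  by rewrite (L_cell n_gt0 Hv L_ops) scaleNr scalerN opprK.
rewrite -/(E al (cell p)) H2 !cur_actD expr2 scalerBl.
set x := cell p; set y1 := E al x; set y2 := E _ x; set y3 := E _ x; set y4 := E _ x.
rewrite opprB -!addrA; congr (_ + (_ + _)).
by rewrite [RHS]addrC -!addrA addNr addr0; congr (_ + _); rewrite addrC addrK.
Qed.

(** Equality modulo the line of the point is the vanishing of the minors of [U] and the point, where
    [U] is [q] times the difference of the two fields. The further factor [q] in [phi] covers cell
    points where the presentation is not valid, so that density applies. *)
Lemma field_eq_on_schubert eta (T : 'End(M)) : vector_field X eta ->
  (forall p q, p * q = 1 -> exists a, eta (cell p) = T (cell p) + a *: cell p) ->
  vf_eq X eta T.
Proof.
case=> _ _ Reta HT x Xx; have [d [q [P [qh Ph qx qE]]]] := Reta _ Xx.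
pose U i y := peval (P i) y - peval q y * coord b i (T y).
pose phi i j y := peval q y * (U i y * coord b j y - U j y * coord b i y).
have Uf i : isform d.+1 (U i).
  apply: isformD; first exact: isform_peval.
  apply: isformN; rewrite -addn1; apply: isformM; first exact: isform_peval.
  exact: (isform_linear (coord b i \o T)%FUN).
have phif i j : isform (d + (d.+1 + 1)) (phi i j).
  apply: isformM; first exact: isform_peval.
  exact: (isformD (isformM (Uf i) (isform_coord j))
    (isformN (isformM (Uf j) (isform_coord i)))).
have phi0 i j : phi i j x = 0.
  apply: (form_dense n_gt0 Hv rho_act (phif i j)) Xx => p p' pp'.
  rewrite /phi; have [->|qp] := eqVneq (peval q (cell p)) 0; first by rewrite mul0r.
  have [c cE] := qE _ (cell_schubert Hv rho_act p) qp; have [a aE] := HT p p' pp'.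
  set y := cell p in qp cE aE *; set Q := peval q y in qp cE *.
  have UE k : U k y = Q * (a - c) * coord b k y.
    have := congr1 (coord b k) aE; rewrite cE !linearD !linearZ /=.
    rewrite coord_sum_free ?(basis_free (vbasisP _)) // => H.
    have -> : U k y = Q * (Q^-1 * peval (P k) y + c * coord b k y) - Q * coord b k (T y)
      - Q * c * coord b k y by rewrite /U; field.
    by rewrite H; ring.
  by rewrite !UE; ring.
have [j xj] : exists j, coord b j x != 0.
  apply/existsP; apply: contraT => /existsPn x0; case: Xx => /eqP[].
  by apply: coord_eq => i; rewrite linear0; apply/eqP/negPn/x0.
have [c cE] := qE _ Xx qx.
exists ((peval q x)^-1 * (U j x / coord b j x) + c); rewrite cE; apply: coord_eq => i.
rewrite !linearD !linearZ /= coord_sum_free ?(basis_free (vbasisP _)) //.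
have /eqP := phi0 i j; rewrite /phi mulf_eq0 (negbTE qx) subr_eq0 => /eqP H.
have -> : peval (P i) x = peval q x * coord b i (T x) + U j x * coord b i x / coord b j x.
  by rewrite -H mulfK // /U; ring.
by field; rewrite xj qx.
Qed.

Lemma fields_free (c : 'I_n + 'I_n + 'I_n + 'I_n.-1 -> C) :
  (forall p, exists a, \sum_k c k *: field_op k (cell p) = a *: cell p) ->
  forall k, c k = 0.
Proof.
move=> c0.
pose al : A := \sum_(i < n) c (inl (inl (inl i))) *: t ^+ i.
pose be : A := \sum_(i < n) (2%:R * c (inl (inl (inr i)))) *: t ^+ i.
pose ga : A := \sum_(i < n) c (inl (inr i)) *: t ^+ i.
pose de : A := \sum_(i < n.-1) c (inr i) *: t ^+ i.
have E_sum m (d : 'I_m -> C) p u :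
    E ((\sum_(i < m) d i *: t ^+ i) * p) u = \sum_(i < m) d i *: E (t ^+ i * p) u.
  rewrite mulr_suml cur_act_sum; apply: eq_bigr => i _.
  by rewrite -scalerAl cur_actZ.
have c1 p : exists a, E (al + be * p - ga * (p * p) - de * tderiv p) (cell p) = a *: cell p.
  have [a aE] := c0 p.
  set x := cell p in aE *.
  pose k1 := \sum_(i < n) c (inl (inl (inr i))) * ((i == 0 :> nat)%:R * lam).
  pose k2 := \sum_(i < n) c (inl (inr i)) * ((i == 0 :> nat)%:R * p`_0 * lam).
  have EN r : E (- r) x = - E r x by rewrite -scaleN1r cur_actZ scaleN1r.
  have H1 : E al x = \sum_(i < n) c (inl (inl (inl i))) *: e_ i x.
    rewrite -[al]mulr1 E_sum; apply: eq_bigr => i _.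
    by rewrite mulr1 (E_tX n_gt0 Hv).
  have H2 : E (be * p) x = \sum_(i < n) c (inl (inl (inr i))) *: h_ i x - k1 *: x.
    rewrite E_sum scaler_suml -sumrB; apply: eq_bigr => i _.
    by rewrite (h_cell n_gt0 Hv) scalerDr !scalerA addrC addKr mulrC.
  have H3 : E (ga * (p * p)) x = - (\sum_(i < n) c (inl (inr i)) *: f_ i x) - k2 *: x.
    rewrite E_sum scaler_suml -sumrN -sumrB; apply: eq_bigr => i _.
    by rewrite (f_cell n_gt0 Hv) scalerBr scaleNr scalerN !scalerA opprD !opprK addrAC
      subrr add0r.
  have H4 : E (de * tderiv p) x = - \sum_(i < n.-1) c (inr i) *: L i x.
    rewrite E_sum -sumrN; apply: eq_bigr => i _.
    by rewrite (L_cell n_gt0 Hv L_ops) scalerN opprK.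
  exists (a - k1 + k2); rewrite !cur_actD !EN H1 H2 H3 H4 scalerDl scalerBl -aE
    sum_field_op.
  rewrite opprD !opprK -!addrA; congr (_ + (_ + _)).
  by rewrite addrCA; congr (_ + _); rewrite addrA addrC.
have eq0 p : al + be * p - ga * (p * p) - de * tderiv p = 0.
  have [a /(congr1 (rho (mx2 1 (- p) 0 1)))] := c1 p.
  rewrite cell_back_E linearZ /= cell_back => /(congr1 yh).
  by rewrite (coord_cell_E n_gt0 Hv) linearZ /= (coord_cell_v Hv) scaler0.
(* Four values of [p] are enough: [0] gives [al = 0]; at [1] and [-1] the derivation vanishes, so
   [be = ga] and [be = - ga]; then [t] gives [de * t = 0]. *)
have td0 : tderiv (0 : A) = 0 by apply: linear0.
have al0 : al = 0 by have := eq0 0; rewrite td0 !(mulr0, addr0, subr0).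
have td1 : tderiv (1 : A) = 0.
  by apply: qpoly_ext => // j _; rewrite coef_tderiv // coefq1 // coef0; case: j => [|j];
    rewrite ?mul0r ?mulr0.
have bg : be = ga.
  have := eq0 1; rewrite al0 td1 !(mulr0, mulr1, subr0, add0r) => /eqP.
  by rewrite subr_eq0 => /eqP.
have be0 : be = 0.
  have tdN : tderiv (- 1 : A) = 0 by rewrite -scaleN1r linearZ /= td1 scaler0.
  have := eq0 (- 1); rewrite al0 tdN -bg mulrNN !(mulr0, mulr1, subr0, add0r).
  rewrite mulrN1 -opprD => /eqP; rewrite oppr_eq0 -mulr2n -scaler_nat scaler_eq0.
  by rewrite pnatr_eq0 => /eqP.
have det0 : de * t = 0.
  have := eq0 t; rewrite al0 -bg be0 !mul0r subr0 add0r sub0r => /eqP.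
  rewrite oppr_eq0 => /eqP; rewrite (_ : tderiv t = t) //.
  apply: qpoly_ext => // j lt; rewrite coef_tderiv // -[t]expr1 coef_tX // lt.
  by case: eqP => [->|_]; rewrite ?mul1r ?mulr0.
have coef_sum m (d : 'I_m -> C) (i : 'I_m) : (m <= n)%N ->
    (\sum_(i < m) d i *: t ^+ i = 0 -> d i = 0).
  move=> mn /(congr1 (fun p : A => (p : {poly C})`_i));
    rewrite coef0 coefq_sum (bigD1 i) //=.
  rewrite coefqZ coef_tX // (leq_trans (ltn_ord i)) // eqxx mulr1 big1 ?addr0 // => j ne.
  rewrite coefqZ coef_tX //; case: eqP => [ij|]; last by rewrite andbF mulr0.
  by case/eqP: ne; apply: val_inj.
case=> [[[i|i]|i]|i].
- exact: (coef_sum n _ i _ al0).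
- have := coef_sum n _ i (leqnn n) be0 => /eqP.
  by rewrite mulf_eq0 pnatr_eq0 => /eqP.
- by rewrite bg in be0; apply: (coef_sum n _ i _ be0).
(* [de] has degree at most [n - 2], so multiplication by [t] loses none of its coefficients. *)
have lt : (i.+1 < n)%N by have := ltn_ord i; rewrite -ltnS prednK.
have := congr1 (fun p : A => (p : {poly C})`_i.+1) det0.
have -> : de * t = \sum_(j < n.-1) c (inr j) *: t ^+ j.+1.
  by rewrite mulr_suml; apply: eq_bigr => j _; rewrite -scalerAl -exprSr.
rewrite coef0 coefq_sum (bigD1 i) //= coefqZ.
rewrite coef_tX // lt eqxx mulr1 big1 ?addr0 // => j ne.
rewrite coefqZ coef_tX // eqSS; case: eqP => [ij|]; last by rewrite andbF mulr0.
by case/eqP: ne; apply: val_inj.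
Qed.

Lemma schubert_fields_basis : vf_basis X (@schubert_fields C M n act L).
Proof.
have opE k x : @schubert_fields C M n act L k x = field_op k x.
  by case: k => [[[]|]|].
split.
- move=> k; apply: (op_vector_field n_gt0 Hv rho_act (T := field_op k)).
  exact: field_op_cell.
- move=> c c0; apply: fields_free => p.
  have [a aE] := c0 _ (cell_schubert Hv rho_act p); exists a.
  by rewrite -[RHS]add0r -aE; apply: eq_bigr => k _; rewrite opE.
move=> eta Heta; have [al [be [ga [de H]]]] := field_quadratic Heta.
have [c cE] := combination_on_cell al be ga de; exists c => x Xx.
pose T : 'End(M) := (\sum_k c k *: field_op k)%VF.
have TE u : T u = \sum_k c k *: field_op k u.
  by rewrite sum_lfunE; apply: eq_bigr => k _; rewrite scale_lfunE.
have HT p q : p * q = 1 -> exists a, eta (cell p) = T (cell p) + a *: cell p.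
  move=> pq; have [a1 ->] := H p q pq; have [a2 ->] := cE p.
  by exists (a2 + a1); rewrite TE scalerDl addrA.
have [a ->] := field_eq_on_schubert Heta HT Xx; exists a; rewrite TE.
by congr (_ + _); apply: eq_bigr => k _; rewrite opE.
Qed.

End Basis.
End Fields.

Theorem theorem1p4 (R : realType) (n : nat) (n_ge1 : (1 <= n)%N)
    (a : 'I_n -> nat) (a_ge2 : forall i, (2 <= a i)%N)
    (a_incr : forall i j : 'I_n, (i < j)%N -> (a i < a j)%N)
    (z : 'I_n -> complex R) (z_inj : injective z)
    (M : vectType (complex R)) (act : 'M[complex R]_2 -> nat -> 'End(M)) (v : M)
    (M_fusion : fusion_product a z act v)
    (rho : 'M[{poly %/ ('X^n : {poly complex R})}]_2 -> 'End(M))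
    (rho_act : integrates act rho)
    (L : nat -> 'End(M)) (L_ops : virasoro_ops act v L) :
  vf_basis (schubert rho v) (@schubert_fields (complex R) M n act L).
Proof.
have [lam Hv] := fusion_lowest_current_module n_ge1 a_ge2 z_inj M_fusion.
exact: (schubert_fields_basis n_ge1 Hv rho_act L_ops).
Qed.
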